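(* Let $d\ge1$, let $(\chi,\mathcal{A}_\chi,\mu)$ be a $\sigma$-finite measure space and let $p:\mathbb{T}^d\times\chi\to\mathbb{R}_{\ge0}$ be jointly measurable with $\int_\chi p(\mathbf{x},y)\,\mu(dy)=1$ for all $\mathbf{x}\in\mathbb{T}^d$. Then the adaptive learnable basis $\mathcal{B}_{able}=\{e_{\mathbf{k},y}\}_{\mathbf{k}\in\mathbb{Z}^d,\,y\in\chi}$, $e_{\mathbf{k},y}(\mathbf{x})=p(\mathbf{x},y)^{1/2}e^{i\mathbf{k}\cdot\mathbf{x}}$, is a Parseval tight frame of $L^2(\mathbb{T}^d,\mathbb{C})$, that is: 1. (Frame inequality) there exist $0<A\le B<\infty$ such that for all $f\in L^2(\mathbb{T}^d,\mathbb{C})$, $$A\|f\|_{L^2(\mathbb{T}^d)}^2\le\int_\chi\sum_{\mathbf{k}\in\mathbb{Z}^d}|\langle f,e_{\mathbf{k},y}\rangle|^2\,\mu(dy)\le B\|f\|_{L^2(\mathbb{T}^d)}^2;$$ 2. (Parseval) one can take $A=B=\frac{1}{(2\pi)^d}$, i.e. for all $f\in L^2(\mathbb{T}^d,\mathbb{C})$, $$\frac{1}{(2\pi)^d}\|f\|_{L^2(\mathbb{T}^d)}^2=\int_\chi\sum_{\mathbf{k}\in\mathbb{Z}^d}|\hat f_{\mathbf{k},y}|^2\,\mu(dy),\qquad \hat f_{\mathbf{k},y}=\langle f,e_{\mathbf{k},y}\rangle.$$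
   Context: $\mathbb{T}^d=\mathbb{R}^d/(2\pi\mathbb{Z})^d$. Here $\|f\|_{L^2(\mathbb{T}^d)}^2=\int_{\mathbb{T}^d}|f(\mathbf{x})|^2d\mathbf{x}$ (unnormalized), while the coefficients are $\langle f,e_{\mathbf{k},y}\rangle=\frac{1}{(2\pi)^d}\int_{\mathbb{T}^d}f(\mathbf{x})p(\mathbf{x},y)^{1/2}e^{-i\mathbf{k}\cdot\mathbf{x}}\,d\mathbf{x}$, defined for every $y$ with $p(\cdot,y)^{1/2}f\in L^2(\mathbb{T}^d)$, hence for $\mu$-a.e. $y$. *)

(* Defs.v *)
From HB Require Import structures.
From mathcomp Require Import all_boot all_order all_algebra generic_quotient.
From mathcomp Require Import all_classical all_reals all_analysis.
From mathcomp Require Import complex.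

Set Implicit Arguments.
Unset Strict Implicit.
Unset Printing Implicit Defensive.

Import Order.TTheory GRing.Theory Num.Theory.
Import numFieldNormedType.Exports.
Import ComplexField.Normc.

Local Open Scope classical_set_scope.
Local Open Scope ring_scope.

Section lebesgue_tuple.
Variable R : realType.

Definition cons_pair n (z : measurableTypeR R * n.-tuple R) : n.+1.-tuple R :=
  [tuple of (z.1 : R) :: z.2].

Let measurable_cons_pair n : measurable_fun setT (@cons_pair n).
Proof.
exact: (@measurable_cons _ _ _ R fst n snd measurable_fst measurable_snd).
Qed.

HB.instance Definition _ n :=
  isMeasurableFun.Build _ _ _ _ (@cons_pair n) (@measurable_cons_pair n).

Section lebesgue_cons.
Local Open Scope ereal_scope.
Variables (n : nat) (m : {sigma_finite_measure set (n.-tuple R) -> \bar R}).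

Definition lebesgue_cons : set (n.+1.-tuple R) -> \bar R :=
  pushforward (@lebesgue_measure R \x m) (@cons_pair n).

Let lebesgue_cons0 : lebesgue_cons set0 = 0.
Proof. exact: measure0. Qed.

Let lebesgue_cons_ge0 A : 0 <= lebesgue_cons A.
Proof. exact: measure_ge0. Qed.

Let lebesgue_cons_sigma_additive : semi_sigma_additive lebesgue_cons.
Proof. exact: measure_semi_sigma_additive. Qed.

HB.instance Definition _ := isMeasure.Build _ _ _ lebesgue_cons
  lebesgue_cons0 lebesgue_cons_ge0 lebesgue_cons_sigma_additive.

Let lebesgue_cons_sigma_finite : sigma_finite setT lebesgue_cons.
Proof.
have /sigma_finiteP[F [TF ndF Foo]] := sigma_finiteT (@lebesgue_measure R).
have /sigma_finiteP[G [TG ndG Goo]] := sigma_finiteT m.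
pose uncons (t : n.+1.-tuple R) : measurableTypeR R * n.-tuple R :=
  (thead t : measurableTypeR R, [tuple of behead t]).
have consK : cancel (@cons_pair n) uncons.
  by move=> [x t]; rewrite /uncons /cons_pair theadE; congr pair; exact: val_inj.
have muncons : measurable_fun setT uncons.
  apply/measurable_fun_pairP; split; last exact: measurable_behead.
  exact: (@measurable_tnth _ R n.+1 ord0).
exists (fun i => uncons @^-1` (F i `*` G i)).
  rewrite -preimage_bigcup; apply/seteqP; split => // t _ /=.
  have [i _ Fi] : (\bigcup_i F i) (uncons t).1 by rewrite -TF.
  have [j _ Gj] : (\bigcup_i G i) (uncons t).2 by rewrite -TG.
  exists (maxn i j) => //; split.
    by move: (uncons t).1 Fi; exact/subsetPset/ndF/leq_maxl.
  by move: (uncons t).2 Gj; exact/subsetPset/ndG/leq_maxr.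
move=> i; have [mF Foo_i] := Foo i; have [mG Goo_i] := Goo i; split.
  by rewrite -[X in measurable X]setTI; apply: muncons => //; exact: measurableX.
rewrite /lebesgue_cons /pushforward -comp_preimage (_ : _ \o _ = id)//.
  by rewrite preimage_id product_measure1E// lte_mul_pinfty// ge0_fin_numE.
by apply/funext => z /=; exact: consK.
Qed.

HB.instance Definition _ := Measure_isSigmaFinite.Build _ _ _ lebesgue_cons
  lebesgue_cons_sigma_finite.
End lebesgue_cons.

Fixpoint lebesgue_tuple n : {sigma_finite_measure set (n.-tuple R) -> \bar R} :=
  match n with
  | 0 => \d_([tuple] : 0.-tuple R)
  | n'.+1 => lebesgue_cons (lebesgue_tuple n')
  end.

Lemma lebesgue_tuple_box n (A : 'I_n -> set (measurableTypeR R)) :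
  (forall i, measurable (A i)) ->
  lebesgue_tuple n [set t | forall i, A i (tnth t i)] =
  (\prod_(i < n) @lebesgue_measure R (A i))%E.
Proof.
elim: n A => [|n IHn] A mA.
  by rewrite big_ord0 /= diracE mem_set// => -[].
pose B : set (n.-tuple R) := [set t | forall i, A (lift ord0 i) (tnth t i)].
have mB : measurable B.
  rewrite (_ : B = \big[setI/setT]_(i < n)
      ((fun t : n.-tuple R => tnth t i) @^-1` A (lift ord0 i))).
    apply: bigsetI_measurable => i _; rewrite -[X in measurable X]setTI.
    by apply: measurable_tnth => //; exact: mA.
  rewrite -bigcap_seq; apply/seteqP; split => t /= At i.
    by move=> _; exact: At.
  by apply: At; rewrite /= mem_index_enum.
rewrite big_ord_recl -IHn//= /lebesgue_cons /pushforward -/B.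
rewrite (_ : _ @^-1` _ = A ord0 `*` B) ?product_measure1E//.
apply/seteqP; split => -[x t] /=.
  move=> At; split; first exact: (At ord0).
  by move=> i; have := At (lift ord0 i); rewrite tnthS.
move=> [A0 At] i; case: (unliftP ord0 i) => [j ->|->//].
by rewrite tnthS; exact: At.
Qed.

End lebesgue_tuple.

Section torus.
Variables (R : realType) (n : nat).
Implicit Types x y : n.-tuple R.

(* x - y lies in the lattice (2 pi Z)^n. *)
Definition torus_rel x y :=
  [forall i, (tnth x i - tnth y i) / (trigo.pi *+ 2) \is a Num.int].

Lemma torus_rel_refl : reflexive torus_rel.
Proof. by move=> x; apply/forallP => i; rewrite subrr mul0r rpred0. Qed.

Lemma torus_rel_sym : symmetric torus_rel.
Proof.
by move=> x y; apply: eq_forallb => i; rewrite -opprB mulNr rpredN.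
Qed.

Lemma torus_rel_trans : transitive torus_rel.
Proof.
move=> y x z /forallP xy /forallP yz; apply/forallP => i.
by rewrite -(subrKA (tnth y i)) mulrDl rpredD.
Qed.

Canonical torus_equiv :=
  EquivRel torus_rel torus_rel_refl torus_rel_sym torus_rel_trans.

Definition torus : Type := {eq_quot torus_rel}%qT.

HB.instance Definition _ := Choice.on torus.
HB.instance Definition _ := EqQuotient.on torus.

Definition torus_proj x : torus := (\pi_torus x)%qT.

HB.instance Definition _ := isPointed.Build torus (torus_proj point).

(* The quotient sigma-algebra; it is the Borel sigma-algebra of the torus, since
   the projection is a countable-to-one local homeomorphism. *)
Let torus_measurable : set (set torus) :=
  [set A | measurable (torus_proj @^-1` A)].

Let torus_measurable0 : torus_measurable set0.
Proof. by rewrite /torus_measurable /= preimage_set0. Qed.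

Let torus_measurableC A : torus_measurable A -> torus_measurable (~` A).
Proof. by rewrite /torus_measurable /= preimage_setC; exact: measurableC. Qed.

Let torus_measurable_bigcup (F : (set torus)^nat) :
  (forall i, torus_measurable (F i)) -> torus_measurable (\bigcup_i F i).
Proof.
move=> mF; rewrite /torus_measurable /= preimage_bigcup.
exact: bigcupT_measurable.
Qed.

HB.instance Definition _ := @isMeasurable.Build default_measure_display torus
  torus_measurable torus_measurable0 torus_measurableC torus_measurable_bigcup.

Let measurable_torus_proj : measurable_fun setT torus_proj.
Proof. by move=> _ A mA; rewrite setTI. Qed.

HB.instance Definition _ :=
  isMeasurableFun.Build _ _ _ _ torus_proj measurable_torus_proj.

Definition torus_cell : set (n.-tuple R) :=
  [set x | forall i, 0 <= tnth x i < trigo.pi *+ 2].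

Lemma measurable_torus_cell : measurable torus_cell.
Proof.
rewrite (_ : torus_cell = \big[setI/setT]_(i < n)
    ((fun x : n.-tuple R => tnth x i) @^-1` `[0, trigo.pi *+ 2[%classic)).
  apply: bigsetI_measurable => i _.
  by rewrite -[X in measurable X]setTI; exact: measurable_tnth.
apply/seteqP; split => x /=.
  by move=> cx; rewrite -bigcap_seq => i _ /=; rewrite in_itv/=; exact: cx.
rewrite -bigcap_seq => cx i.
by have := cx i (mem_index_enum _); rewrite /= in_itv.
Qed.

(* Unnormalized Haar measure, of total mass (2 pi)^n: Lebesgue measure on the
   fundamental cell [0, 2 pi)^n carried to the quotient. *)
Definition torus_measure : set torus -> \bar R :=
  pushforward (mrestr (lebesgue_tuple R n) measurable_torus_cell) torus_proj.

Let torus_measure0 : torus_measure set0 = 0%E.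
Proof. exact: measure0. Qed.

Let torus_measure_ge0 A : (0 <= torus_measure A)%E.
Proof. exact: measure_ge0. Qed.

Let torus_measure_sigma_additive : semi_sigma_additive torus_measure.
Proof. exact: measure_semi_sigma_additive. Qed.

HB.instance Definition _ := isMeasure.Build _ _ _ torus_measure
  torus_measure0 torus_measure_ge0 torus_measure_sigma_additive.

End torus.

Section fourier_char.
Variables (R : realType) (n : nat).

Definition expi (t : R) : R[i] := (cos t +i* sin t)%C.

Definition dot_int (k : n.-tuple int) (x : n.-tuple R) : R :=
  \sum_(i < n) (tnth k i)%:~R * tnth x i.

(* x |-> e^{i k.x}, read off an arbitrary representative of x; see
   fourier_char_proj for the independence of that choice. *)
Definition fourier_char (k : n.-tuple int) (x : torus R n) : R[i] :=
  expi (dot_int k (repr x)).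

Lemma expiD2pi (t : R) (m : int) : expi (t + trigo.pi *+ 2 *~ m) = expi t.
Proof.
have pos (s : R) j : expi (s + trigo.pi *+ 2 *+ j) = expi s.
  by rewrite /expi (periodicn (@cosD2pi R)) (periodicn (@sinD2pi R)).
case: m => j; first exact: pos.
by rewrite NegzE mulrNz -(pos (t - _) j.+1) -pmulrn subrK.
Qed.

Lemma fourier_char_proj (k : n.-tuple int) (x : n.-tuple R) :
  fourier_char k (torus_proj x) = expi (dot_int k x).
Proof.
have /forallP/= xP : torus_rel (repr (torus_proj x)) x.
  by rewrite -[torus_rel _ _]/(torus_equiv R n _ _) -eqmodE reprK.
rewrite /fourier_char; set y := repr _ in xP *.
have /choice[m mP] i : exists m : int,
    tnth y i - tnth x i = trigo.pi *+ 2 *~ m.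
  have /intrP[m yx] := xP i; exists m.
  by rewrite -mulrzl -yx divfK// mulrn_eq0/= gt_eqF// pi_gt0.
suff -> : dot_int k y =
    dot_int k x + trigo.pi *+ 2 *~ (\sum_(i < n) tnth k i * m i).
  exact: expiD2pi.
rewrite /dot_int mulrz_sumr -big_split/=; apply: eq_bigr => i _.
by rewrite (mulrC (tnth k i)) mulrzA -mP -(mulrzl (_ - _)) -mulrDr addrC subrK.
Qed.

End fourier_char.

Section L2_torus.
Variables (R : realType) (n : nat).
Implicit Types f g : torus R n -> R[i].

(* Squared norm for the unnormalized measure, infinite when f is not in L^2. *)
Definition L2normsq f : \bar R :=
  (\int[@torus_measure R n]_x (normc (f x) ^+ 2)%:E)%E.

(* Functions rather than classes modulo a.e. equality: L2normsq and coef below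
   only depend on the class. *)
Definition L2 f : Prop :=
  [/\ measurable_fun setT (fun x => complex.Re (f x)),
      measurable_fun setT (fun x => complex.Im (f x)) &
      (L2normsq f < +oo)%E].

(* Meaningful when the real and imaginary parts are integrable. *)
Definition torus_integral f : R[i] :=
  (Rintegral (@torus_measure R n) setT (fun x => complex.Re (f x)) +i*
   Rintegral (@torus_measure R n) setT (fun x => complex.Im (f x)))%C.

(* <f, g>, normalized by (2 pi)^-n contrary to L2normsq. *)
Definition coef f g : R[i] :=
  ((trigo.pi *+ 2) ^- n)%:C%C * torus_integral (fun x => f x * (g x)^*%C).

End L2_torus.

Section learnable_basis.
Variables (R : realType) (n : nat) (chi : Type) (p : torus R n * chi -> R).

Definition learnable_basis (k : n.-tuple int) (y : chi) (x : torus R n) : R[i] :=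
  (Num.sqrt (p (x, y)))%:C%C * fourier_char k x.

Lemma coef_learnable_basis (f : torus R n -> R[i]) k y :
  coef f (learnable_basis k y) =
  ((trigo.pi *+ 2) ^- n)%:C%C * torus_integral
    (fun x => f x * (Num.sqrt (p (x, y)))%:C%C * expi (- dot_int k (repr x))).
Proof.
congr (_ * torus_integral _); apply/funext => x.
rewrite -mulrA; congr (_ * _); apply/eqP; rewrite eq_complex /= cosN sinN.
by rewrite !mul0r !addr0 mulrN oppr0 !addr0 !eqxx.
Qed.

End learnable_basis.

(* Main.v *)
(** For almost every y the function g_y = p(., y)^(1/2) f is square integrable,
    since by Tonelli the integral over y of ||g_y||^2 is ||f||^2, and
    <f, e_{k,y}> is the k-th Fourier coefficient of g_y.  The theorem is thus
    Parseval's identity for each g_y, integrated over y.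

    Parseval's identity on the torus follows from Bessel's inequality and the
    density of trigonometric polynomials in L^2.  For the density, iterating
    (3 t - t^3) / 2 on a trigonometric polynomial bounded by 1 produces
    trigonometric polynomials converging pointwise to its sign, so the indicators
    of its superlevel sets are L^2-limits of trigonometric polynomials; these sets
    generate the sigma-algebra, and Dynkin's lemma extends this to every measurable
    set, hence to every square integrable function. *)

Require Import Defs.
From HB Require Import structures.
From mathcomp Require Import all_boot all_order all_algebra generic_quotient.
From mathcomp Require Import all_classical all_reals all_analysis.
From mathcomp Require Import complex.
From mathcomp Require Import measurable_realfun ring lra.

Import Order.TTheory GRing.Theory Num.Theory.
Import numFieldNormedType.Exports.
Import ComplexField.Normc.

Local Open Scope classical_set_scope.
Local Open Scope ring_scope.

(** * Bessel's inequality *)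

Section complex_square_integrable.
Context {disp : measure_display} {T : measurableType disp} {R : realType}.
Variable m : {finite_measure set T -> \bar R}.
Implicit Types (f g : T -> R[i]) (c : R[i]).

Lemma sqr_normc c : normc c ^+ 2 = complex.Re c ^+ 2 + complex.Im c ^+ 2.
Proof. by case: c => a b /=; rewrite sqr_sqrtr ?addr_ge0 ?sqr_ge0. Qed.

(** Abstract counterpart of [L2]. On the torus the two are convertible, so the abstract theorems
    apply directly to functions in [L2]. *)
Definition sqint f : Prop :=
  [/\ measurable_fun setT (fun x => complex.Re (f x)),
      measurable_fun setT (fun x => complex.Im (f x)) &
      (\int[m]_x (normc (f x) ^+ 2)%:E < +oo)%E].

(** The inner product, linear in the first argument and unnormalized: a unimodular function has
    squared norm [m setT]. *)
Definition cip f g : R[i] :=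
  (\int[m]_x complex.Re (f x * (g x)^*%C) +i*
   \int[m]_x complex.Im (f x * (g x)^*%C))%C.

Lemma measurable_sqr_normc f : measurable_fun setT (fun x => complex.Re (f x)) ->
  measurable_fun setT (fun x => complex.Im (f x)) ->
  measurable_fun setT (fun x => normc (f x) ^+ 2).
Proof.
move=> mr mi; under eq_fun do rewrite sqr_normc.
by apply: measurable_funD; exact: measurable_funX.
Qed.

Lemma sqint_integrable f : sqint f ->
  m.-integrable setT (EFin \o (fun x => normc (f x) ^+ 2)).
Proof.
move=> [mr mi fi]; apply/integrableP; split.
  by apply/measurable_EFinP; exact: measurable_sqr_normc.
by under eq_integral do rewrite /= ger0_norm ?sqr_ge0//.
Qed.

Lemma ReMconj (a b : R[i]) : complex.Re (a * b^*%C) =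
  complex.Re a * complex.Re b + complex.Im a * complex.Im b.
Proof. by case: a b => [a b] [c e] /=; rewrite mulrN opprK. Qed.

Lemma ImMconj (a b : R[i]) : complex.Im (a * b^*%C) =
  complex.Im a * complex.Re b - complex.Re a * complex.Im b.
Proof. by case: a b => [a b] [c e] /=; rewrite mulrN; ring. Qed.

(** Follows from the nonnegativity of the squares of sums and differences of coordinates. It
    provides the integrable dominating function that makes the inner product of two square
    integrable functions meaningful. *)
Lemma le_normr_ReMconj (a b : R[i]) :
  `|complex.Re (a * b^*%C)| <= normc a ^+ 2 + normc b ^+ 2.
Proof.
rewrite ReMconj !sqr_normc; case: a b => [a b] [c e] /=.
have := (sqr_ge0 (a + c), sqr_ge0 (b + e), sqr_ge0 (a - c), sqr_ge0 (b - e)).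
by move=> [[[? ?] ?] ?]; rewrite ler_norml; apply/andP; split; nra.
Qed.

Lemma le_normr_ImMconj (a b : R[i]) :
  `|complex.Im (a * b^*%C)| <= normc a ^+ 2 + normc b ^+ 2.
Proof.
rewrite ImMconj !sqr_normc; case: a b => [a b] [c e] /=.
have := (sqr_ge0 (b + c), sqr_ge0 (a + e), sqr_ge0 (b - c), sqr_ge0 (a - e)).
by move=> [[[? ?] ?] ?]; rewrite ler_norml; apply/andP; split; nra.
Qed.

Lemma measurable_ReMconj f g :
  measurable_fun setT (fun x => complex.Re (f x)) ->
  measurable_fun setT (fun x => complex.Im (f x)) ->
  measurable_fun setT (fun x => complex.Re (g x)) ->
  measurable_fun setT (fun x => complex.Im (g x)) ->
  measurable_fun setT (fun x => complex.Re (f x * (g x)^*%C)).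
Proof.
move=> ? ? ? ?; under eq_fun do rewrite ReMconj.
by apply: measurable_funD; exact: measurable_funM.
Qed.

Lemma measurable_ImMconj f g :
  measurable_fun setT (fun x => complex.Re (f x)) ->
  measurable_fun setT (fun x => complex.Im (f x)) ->
  measurable_fun setT (fun x => complex.Re (g x)) ->
  measurable_fun setT (fun x => complex.Im (g x)) ->
  measurable_fun setT (fun x => complex.Im (f x * (g x)^*%C)).
Proof.
move=> ? ? ? ?; under eq_fun do rewrite ImMconj.
by apply: measurable_funB; exact: measurable_funM.
Qed.

Lemma integrable_ReMconj f g : sqint f -> sqint g ->
  m.-integrable setT (EFin \o (fun x => complex.Re (f x * (g x)^*%C))).
Proof.
move=> sf sg; have [mrf mif _] := sf; have [mrg mig _] := sg.
apply: (le_integrable measurableT _ _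
  (integrableD measurableT (sqint_integrable _ sf) (sqint_integrable _ sg))).
  by apply/measurable_EFinP; exact: measurable_ReMconj.
move=> x _ /=; rewrite lee_fin (le_trans (le_normr_ReMconj _ _))//.
exact: ler_norm.
Qed.

Lemma integrable_ImMconj f g : sqint f -> sqint g ->
  m.-integrable setT (EFin \o (fun x => complex.Im (f x * (g x)^*%C))).
Proof.
move=> sf sg; have [mrf mif _] := sf; have [mrg mig _] := sg.
apply: (le_integrable measurableT _ _
  (integrableD measurableT (sqint_integrable _ sf) (sqint_integrable _ sg))).
  by apply/measurable_EFinP; exact: measurable_ImMconj.
move=> x _ /=; rewrite lee_fin (le_trans (le_normr_ImMconj _ _))//.
exact: ler_norm.
Qed.

Lemma sqr_normcB (a b : R[i]) : normc (a - b) ^+ 2 =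
  normc a ^+ 2 - complex.Re (a * b^*%C) *+ 2 + normc b ^+ 2.
Proof. by rewrite ReMconj !sqr_normc; case: a b => [a b] [c e] /=; ring. Qed.

(** The parallelogram law with the term [normc (a + b) ^+ 2] dropped. *)
Lemma sqr_normcB_le (a b : R[i]) :
  normc (a - b) ^+ 2 <= normc a ^+ 2 *+ 2 + normc b ^+ 2 *+ 2.
Proof.
rewrite !sqr_normc; case: a b => [a b] [c e] /=.
by have := (sqr_ge0 (a + c), sqr_ge0 (b + e)) => -[? ?]; nra.
Qed.

Lemma sqintB f g : sqint f -> sqint g -> sqint (fun x => f x - g x).
Proof.
move=> sf sg; have [mrf mif _] := sf; have [mrg mig _] := sg.
have mr : measurable_fun setT (fun x => complex.Re (f x - g x)).
  by under eq_fun do rewrite raddfB/=; exact: measurable_funB.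
have mi : measurable_fun setT (fun x => complex.Im (f x - g x)).
  by under eq_fun do rewrite raddfB/=; exact: measurable_funB.
split => //.
have i2 h : sqint h -> m.-integrable setT (EFin \o (fun x => 2 * normc (h x) ^+ 2)).
  by move=> sh; exact: (integrableZl measurableT 2 (sqint_integrable _ sh)).
have /integrableP[_] : m.-integrable setT (EFin \o (fun x => normc (f x - g x) ^+ 2)).
  apply: (le_integrable measurableT _ _ (integrableD measurableT (i2 _ sf) (i2 _ sg))).
    by apply/measurable_EFinP; exact: measurable_sqr_normc.
  move=> x _ /=; rewrite lee_fin ger0_norm ?sqr_ge0//.
  by rewrite (le_trans _ (ler_norm _))// !mulr_natl sqr_normcB_le.
by under eq_integral do rewrite /= ger0_norm ?sqr_ge0//.
Qed.

Lemma bounded_sqint f (C : R) :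
  measurable_fun setT (fun x => complex.Re (f x)) ->
  measurable_fun setT (fun x => complex.Im (f x)) ->
  (forall x, normc (f x) ^+ 2 <= C) -> sqint f.
Proof.
move=> mr mi fC; split => //.
apply: (@le_lt_trans _ _ (\int[m]_x C%:E)%E).
  apply: ge0_le_integral => //.
  - by move=> x _; rewrite lee_fin sqr_ge0.
  - by apply/measurable_EFinP; exact: measurable_sqr_normc.
  - by move=> x _; rewrite lee_fin.
rewrite integral_cst// ltey_eq; apply/orP; left.
by rewrite fin_numM// fin_num_measure.
Qed.

End complex_square_integrable.

(** * Finite expansions in an orthogonal family of unimodular functions *)

Section orthogonal_family.
Context {disp : measure_display} {T : measurableType disp} {R : realType}.
Variable m : {finite_measure set T -> \bar R}.
Variables (K : choiceType) (e : K -> T -> R[i]).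
Hypothesis mRe_e : forall k, measurable_fun setT (fun x => complex.Re (e k x)).
Hypothesis mIm_e : forall k, measurable_fun setT (fun x => complex.Im (e k x)).
Hypothesis norm_e : forall k x, normc (e k x) = 1.
Hypothesis ortho_e : forall k l, k != l -> cip m (e k) (e l) = 0.
Let M := fine (m setT).
Implicit Types (f g : T -> R[i]).

Lemma sqint_scale_family (c : R[i]) k : sqint m (fun x => c * e k x).
Proof.
apply: (@bounded_sqint _ _ _ _ _ (normc c ^+ 2)).
- have -> : (fun x => complex.Re (c * e k x)) =
      (fun x => complex.Re c * complex.Re (e k x) - complex.Im c * complex.Im (e k x)).
    by apply/funext => x; case: c (e k x) => [? ?] [? ?].
  by apply: measurable_funB; apply: measurable_funM.
- have -> : (fun x => complex.Im (c * e k x)) =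
      (fun x => complex.Re c * complex.Im (e k x) + complex.Im c * complex.Re (e k x)).
    by apply/funext => x; case: c (e k x) => [? ?] [? ?].
  by apply: measurable_funD; apply: measurable_funM.
- by move=> x; rewrite normcM norm_e mulr1.
Qed.

Lemma sqint_family k : sqint m (e k).
Proof.
by have := sqint_scale_family 1 k; under eq_fun do rewrite mul1r.
Qed.

(** Linearity and orthogonality. This lets the expansion of the squared distance to a finite sum
    proceed one index at a time. *)
Lemma cipB_family f (c : R[i]) k l : sqint m f -> l != k ->
  cip m (fun x => f x - c * e l x) (e k) = cip m f (e k).
Proof.
move=> sf lk; have sk := sqint_family k; have sl := sqint_family l.
have /eqP := ortho_e _ _ lk; rewrite eq_complex /= => /andP[/eqP r0 /eqP i0].
have ir := integrable_ReMconj _ _ _ sl sk.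
have ii := integrable_ImMconj _ _ _ sl sk.
have irZ (a : R) := integrableZl measurableT a ir.
have iiZ (a : R) := integrableZl measurableT a ii.
have fr := integrable_ReMconj _ _ _ sf sk.
have fi := integrable_ImMconj _ _ _ sf sk.
rewrite /cip; congr (_ +i* _)%C.
- rewrite (@eq_Rintegral _ _ _ m setT (fun x =>
    complex.Re (f x * (e k x)^*%C) -
    (complex.Re c * complex.Re (e l x * (e k x)^*%C)
      - complex.Im c * complex.Im (e l x * (e k x)^*%C)))); last first.
    move=> x _ /=.
    by rewrite !ReMconj ImMconj; case: (f x) c (e l x) => [? ?] [? ?] [? ?] /=; ring.
  rewrite RintegralB//; last exact: (integrableB measurableT (irZ _) (iiZ _)).
  rewrite RintegralB//; [|exact: irZ|exact: iiZ].
  by rewrite !RintegralZl// r0 i0 !mulr0 !subr0.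
- rewrite (@eq_Rintegral _ _ _ m setT (fun x =>
    complex.Im (f x * (e k x)^*%C) -
    (complex.Re c * complex.Im (e l x * (e k x)^*%C)
      + complex.Im c * complex.Re (e l x * (e k x)^*%C)))); last first.
    move=> x _ /=.
    by rewrite !ImMconj ReMconj; case: (f x) c (e l x) => [? ?] [? ?] [? ?] /=; ring.
  rewrite RintegralB//; last exact: (integrableD measurableT (iiZ _) (irZ _)).
  rewrite RintegralD//; [|exact: iiZ|exact: irZ].
  by rewrite !RintegralZl// r0 i0 !mulr0 addr0 subr0.
Qed.

(** The square is expanded pointwise; since [e k] has modulus 1, its last term is the constant
    [normc c ^+ 2], whose integral carries the factor [M]. *)
Lemma Rintegral_sqr_normcB_family f (c : R[i]) k : sqint m f ->
  \int[m]_x normc (f x - c * e k x) ^+ 2 =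
  \int[m]_x normc (f x) ^+ 2 - complex.Re (c^*%C * cip m f (e k)) *+ 2 + M * normc c ^+ 2.
Proof.
move=> sf; have sk := sqint_family k.
have fr := integrable_ReMconj _ _ _ sf sk.
have fi := integrable_ImMconj _ _ _ sf sk.
have fn := sqint_integrable _ _ sf.
have ir := integrableZl measurableT (complex.Re c *+ 2) fr.
have ii := integrableZl measurableT (complex.Im c *+ 2) fi.
have i0 := integrableD measurableT ir ii.
have ic : m.-integrable setT (EFin \o cst (normc c ^+ 2)).
  exact: finite_measure_integrable_cst.
rewrite (@eq_Rintegral _ _ _ m setT (fun x => normc (f x) ^+ 2 -
  (complex.Re c *+ 2 * complex.Re (f x * (e k x)^*%C) +
   complex.Im c *+ 2 * complex.Im (f x * (e k x)^*%C)) + normc c ^+ 2)); last first.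
  move=> x _ /=.
  rewrite sqr_normcB normcM norm_e mulr1 !ReMconj !ImMconj.
  by clear ir ii i0 ic; case: (f x) c (e k x) => [? ?] [? ?] [? ?] /=; ring.
rewrite RintegralD//; last exact: (integrableB measurableT fn i0).
rewrite RintegralB//.
rewrite RintegralD//.
rewrite Rintegral_cst// !RintegralZl// /cip /M.
clear ir ii i0 ic; case: c => a b /=; ring.
Qed.

(** Induction on [s], replacing [f] by [f - d k * e k]: as [k] does not occur in the tail, the
    coefficients at the remaining indices are unchanged. *)
Lemma Rintegral_sqr_normc_sub_sum f (d : K -> R[i]) (s : seq K) :
  sqint m f -> uniq s ->
  \int[m]_x normc (f x - \sum_(k <- s) d k * e k x) ^+ 2 =
  \int[m]_x normc (f x) ^+ 2 + \sum_(k <- s)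
    (M * normc (d k) ^+ 2 - complex.Re ((d k)^*%C * cip m f (e k)) *+ 2).
Proof.
elim: s f => [|k s IHs] f sf /=.
  by move=> _; rewrite big_nil addr0; under eq_Rintegral do rewrite big_nil subr0.
move=> /andP[ks us]; under eq_Rintegral do rewrite big_cons opprD addrA.
have sfk : sqint m (fun x => f x - d k * e k x).
  by apply: sqintB => //; exact: sqint_scale_family.
rewrite IHs// Rintegral_sqr_normcB_family// big_cons !addrA; congr (_ + _); first by ring.
rewrite !big_seq; apply: eq_bigr => l ls; rewrite cipB_family//.
by apply: contraNneq ks => ->.
Qed.

Lemma bessel f (s : seq K) : sqint m f -> uniq s -> 0 < M ->
  \sum_(k <- s) normc (cip m f (e k)) ^+ 2 <= M * \int[m]_x normc (f x) ^+ 2.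
Proof.
move=> sf us M0.
(* These are the coefficients of the orthogonal projection, [e k] having squared norm [M]. *)
have : 0 <= \int[m]_x normc (f x - \sum_(k <- s) (M^-1%:C * cip m f (e k))%C * e k x) ^+ 2.
  by apply: Rintegral_ge0 => x _; exact: sqr_ge0.
rewrite Rintegral_sqr_normc_sub_sum//.
rewrite (_ : \sum_(k <- s) _ = - M^-1 * \sum_(k <- s) normc (cip m f (e k)) ^+ 2).
  by rewrite mulNr subr_ge0 mulrC ler_pdivrMr// mulrC.
rewrite mulr_sumr; apply: eq_bigr => k _; rewrite !sqr_normc.
case: (cip m f (e k)) => a b /=; have : M != 0 by rewrite gt_eqF.
by move=> M1; rewrite !mul0r !addr0 subr0; field.
Qed.

(** Completing the square: the two sides differ by the sum of the squared moduli of
    [M * d k - cip m f (e k)]. Any good approximation of [f] thus bounds the sum of squared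
    coefficients from below. *)
Lemma le_bessel_remainder f (d : K -> R[i]) (s : seq K) : sqint m f -> uniq s -> 0 < M ->
  M * \int[m]_x normc (f x) ^+ 2 <= \sum_(k <- s) normc (cip m f (e k)) ^+ 2 +
    M * \int[m]_x normc (f x - \sum_(k <- s) d k * e k x) ^+ 2.
Proof.
move=> sf us M0; rewrite Rintegral_sqr_normc_sub_sum// mulrDr addrCA lerDl.
rewrite mulr_sumr -big_split; apply: sumr_ge0 => k _.
move: (cip m f (e k)) (d k) => [a b] [u v]; rewrite !sqr_normc /=.
rewrite [leRHS](_ : _ = (M * u - a) ^+ 2 + (M * v - b) ^+ 2); last by ring.
by rewrite addr_ge0 ?sqr_ge0.
Qed.

End orthogonal_family.

(** * L^2-density of algebras of bounded functions *)

Section sign_iteration.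
Context {R : realType}.
Implicit Types r q : R.

(* (3 t - t ^ 3) / 2 has the super-attracting fixed points -1 and 1, so its
   iterates converge to the sign function on [-1, 1]. *)
Definition sgn_step r : R := (r *+ 3 - r ^+ 3) / 2.

Lemma sgn_step_itv r : `|r| <= 1 -> `|sgn_step r| <= 1.
Proof.
rewrite !ler_norml /sgn_step => /andP[r1 r2]; apply/andP; split.
  (* The derivative of [sgn_step] vanishes at -1 and 1, whence the double roots in this
     factorization and the next. *)
  rewrite -subr_ge0 (_ : _ - _ = (1 + r) ^+ 2 * (2 - r) / 2); last by field.
  by rewrite !mulr_ge0 ?sqr_ge0 ?invr_ge0//; lra.
rewrite -subr_ge0 (_ : _ - _ = (1 - r) ^+ 2 * (2 + r) / 2); last by field.
by rewrite !mulr_ge0 ?sqr_ge0 ?invr_ge0//; lra.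
Qed.

Lemma iter_sgn_step_itv n r : `|r| <= 1 -> `|iter n sgn_step r| <= 1.
Proof. by move=> r1; elim: n => //= n; exact: sgn_step_itv. Qed.

Lemma iter_sgn_stepN n r : iter n sgn_step (- r) = - iter n sgn_step r.
Proof. by elim: n => //= n ->; rewrite /sgn_step; field. Qed.

(** The iterates increase, so each iterate t is at least r, and the distance to 1 is multiplied by 1
    - t (1 + t) / 2, which is at most 1 - r / 2. *)
Lemma iter_sgn_step_gt0 n r : 0 < r <= 1 ->
  r <= iter n sgn_step r <= 1 /\ 1 - iter n sgn_step r <= (1 - r / 2) ^+ n.
Proof.
move=> /andP[r0 r1]; elim: n => [|n [/= /andP[rn n1] IHn]] /=.
  by rewrite lexx expr0; split => //; rewrite lerBlDr lerDl ltW.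
move: (iter n sgn_step r) => t in rn n1 IHn *.
have t0 : 0 < t by exact: lt_le_trans rn.
have -> : 1 - sgn_step t = (1 - t) * (1 - t * (1 + t) / 2).
  by rewrite /sgn_step; field.
split; last first.
  rewrite exprS mulrC ler_pM//; [|lra|nra].
  by rewrite subr_ge0; nra.
rewrite /sgn_step; apply/andP; split; last first.
  by have := sgn_step_itv t; rewrite !ler_norml /sgn_step; nra.
rewrite (le_trans rn)// -subr_ge0 (_ : _ - _ = t * ((1 - t) * (1 + t)) / 2); last by field.
by rewrite !mulr_ge0 ?invr_ge0//; lra.
Qed.

Lemma cvg_iter_sgn_step r : `|r| <= 1 -> iter n sgn_step r @[n --> \oo] --> Num.sg r.
Proof.
have pos t : 0 < t <= 1 -> iter n sgn_step t @[n --> \oo] --> (1 : R).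
  move=> /andP[t0 t1]; apply/cvgrPdist_le => e e0.
  have /cvgrPdist_le/(_ _ e0) : (1 - t / 2) ^+ n @[n --> \oo] --> (0 : R).
    by apply: cvg_expr; rewrite ger0_norm; lra.
  apply: filterS => n; rewrite sub0r normrN.
  have [|/andP[tn n1] le1] := iter_sgn_step_gt0 n t; first by rewrite t0.
  rewrite ger0_norm; last by rewrite exprn_ge0//; lra.
  by rewrite ger0_norm ?subr_ge0//; exact: le_trans.
rewrite ler_norml => /andP[r1 r2]; case: (ltgtP 0 r) => [r0|r0|<-].
- by rewrite gtr0_sg//; apply: pos; rewrite r0.
- rewrite ltr0_sg//; have := pos (- r); rewrite oppr_gt0 r0/= lerNl r1 => /(_ isT) h.
  rewrite (_ : (fun n => iter n _ _) = (fun n => - iter n sgn_step (- r))).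
    exact: cvgN.
  by apply/funext => n; rewrite iter_sgn_stepN opprK.
- rewrite sgr0 (_ : (fun n => iter n _ _) = cst 0); first exact: cvg_cst.
  by apply/funext; elim => //= n ->; rewrite /sgn_step; field.
Qed.

End sign_iteration.

(** * L^2-density of an algebra of bounded functions that generates the sigma-algebra *)

Section algebra_density.
Context {disp : measure_display} {T : measurableType disp} {R : realType}.
Variable m : {finite_measure set T -> \bar R}.
Variable V : set (T -> R).
Hypothesis V_measurable : forall f, V f -> measurable_fun setT f.
Hypothesis V_bounded : forall f, V f -> exists C, forall x, `|f x| <= C.
Hypothesis V_cst : forall c, V (fun=> c).
Hypothesis V_add : forall f g, V f -> V g -> V (fun x => f x + g x).
Hypothesis V_mul : forall f g, V f -> V g -> V (fun x => f x * g x).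
Hypothesis V_generates :
  @measurable _ T `<=` <<s [set A | exists2 f, V f & A = [set x | 0 <= f x]] >>.
Implicit Types (f g u v w : T -> R).

Let sqdist u v : \bar R := (\int[m]_x ((u x - v x) ^+ 2)%:E)%E.

Definition approximable u : Prop := measurable_fun setT u /\
  forall eps : R, 0 < eps -> exists2 v, V v & (sqdist u v < eps%:E)%E.

Let measurable_sqdist u v : measurable_fun setT u -> measurable_fun setT v ->
  measurable_fun setT (fun x => ((u x - v x) ^+ 2)%:E).
Proof.
by move=> mu mv; apply/measurable_EFinP/measurable_funX; exact: measurable_funB.
Qed.

(** Integrates (a + b)^2 <= 2 a^2 + 2 b^2; it replaces the triangle inequality, distances being kept
    squared. *)
Let sqdist_le w u v : measurable_fun setT u -> measurable_fun setT v ->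
  measurable_fun setT w -> (sqdist u v <= 2%:E * sqdist u w + 2%:E * sqdist w v)%E.
Proof.
move=> mu mv mw; rewrite /sqdist.
have m2 f g : measurable_fun setT f -> measurable_fun setT g ->
    measurable_fun setT (fun x => 2%:E * ((f x - g x) ^+ 2)%:E)%E.
  by move=> mf mg; apply: measurable_funeM; exact: measurable_sqdist.
have s0 f g x : setT x -> (0 <= ((f x - g x) ^+ 2)%:E)%E by rewrite lee_fin sqr_ge0.
have s20 f g x : setT x -> (0 <= 2%:E * ((f x - g x) ^+ 2)%:E)%E.
  by move=> _; rewrite mule_ge0 ?s0.
rewrite -!ge0_integralZl//; do ?[exact: measurable_sqdist|exact: s0].
rewrite -ge0_integralD//; do ?[exact: m2|exact: s20].
apply: ge0_le_integral => //.
- by move=> x _; rewrite lee_fin sqr_ge0.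
- exact: measurable_sqdist.
- by apply: emeasurable_funD; exact: m2.
- by move=> x _; rewrite -!EFinM -EFinD lee_fin; have := sqr_ge0 (u x - w x - (w x - v x)); nra.
Qed.

Let approximable_lim u : measurable_fun setT u ->
  (forall eps : R, 0 < eps -> exists2 v, approximable v & (sqdist u v < eps%:E)%E) ->
  approximable u.
Proof.
(* A quarter of [eps] for each of two distances, as [sqdist_le] doubles both. *)
move=> mu h; split => // eps e0; have e4 : 0 < eps / 4 by rewrite divr_gt0.
have [v [mv /(_ _ e4)[w Vw vw]] uv] := h _ e4; exists w => //.
apply: (le_lt_trans (sqdist_le v _ _ mu (V_measurable _ Vw) mv)).
rewrite (_ : eps%:E = 2%:E * (eps / 4)%:E + 2%:E * (eps / 4)%:E)%E; last first.
  by rewrite -EFinM -EFinD; congr EFin; field.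
by apply: lteD; rewrite lte_pmul2l.
Qed.

(** Dominated convergence for the functions [(u - w n) ^+ 2], which are bounded by [4 * g ^+ 2],
    turns pointwise convergence into L^2 convergence. *)
Let approximable_dominated (w : nat -> T -> R) u g :
  (forall n, approximable (w n)) -> measurable_fun setT u -> measurable_fun setT g ->
  (\int[m]_x ((g x) ^+ 2)%:E < +oo)%E ->
  (forall x, `|u x| <= g x) -> (forall n x, `|w n x| <= g x) ->
  (forall x, w n x @[n --> \oo] --> u x) -> approximable u.
Proof.
move=> aw mu mg ig ug wg wu; apply: approximable_lim => // eps e0.
have [|||||_ _] := @dominated_convergence _ _ _ m setT measurableT
    (fun n x => ((u x - w n x) ^+ 2)%:E) (cst 0%E) (fun x => 4%:E * ((g x) ^+ 2)%:E)%E.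
- by move=> n; apply: measurable_sqdist => //; have [] := aw n.
- exact: measurable_cst.
- apply: aeW => x _; apply: cvg_EFin; first exact: nearW.
  have c : u x - w n x @[n --> \oo] --> (0 : R).
    by rewrite -(subrr (u x)); apply: cvgB => //; exact: cvg_cst.
  by rewrite -[0](mul0r 0) /comp/=; under eq_fun do rewrite expr2; exact: cvgM.
- apply: integrableZl => //; apply/integrableP; split.
    by apply/measurable_EFinP; exact: measurable_funX.
  by under eq_integral do rewrite /= ger0_norm ?sqr_ge0//.
- apply: aeW => x n _ /=; rewrite lee_fin ger0_norm ?sqr_ge0//.
  have := ug x; have := wg n x; rewrite !ler_norml => /andP[? ?] /andP[? ?].
  have : 0 <= (2 * g x - (u x - w n x)) * (2 * g x + (u x - w n x)).
    by rewrite mulr_ge0//; lra.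
  by nra.
rewrite integral_cst// mul0e.
have e0' : (0 < eps%:E)%E by rewrite lte_fin.
by move=> /(_ _ (open_ereal_lt' e0'))[N _ /(_ N (leqnn N)) /= lte]; exists (w N).
Qed.

Let approximable_V v : V v -> approximable v.
Proof.
move=> Vv; split=> [|eps e0]; first exact: V_measurable.
exists v => //; rewrite /sqdist; under eq_integral do rewrite subrr expr0n.
by rewrite integral0 lte_fin.
Qed.

Let approximableD u v : approximable u -> approximable v ->
  approximable (fun x => u x + v x).
Proof.
move=> [mu au] [mv av]; split; first exact: measurable_funD.
move=> eps e0; have e4 : 0 < eps / 4 by rewrite divr_gt0.
have [u' Vu' uu'] := au _ e4; have [v' Vv' vv'] := av _ e4.
have mu' := V_measurable _ Vu'; have mv' := V_measurable _ Vv'.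
exists (fun x => u' x + v' x); first exact: V_add.
(* Passing through [u' + v] changes one summand at a time. *)
have mw : measurable_fun setT (fun x => u' x + v x) by exact: measurable_funD.
have := sqdist_le (fun x => u' x + v x) _ _
  (measurable_funD mu mv) (measurable_funD mu' mv') mw.
rewrite (_ : sqdist (u \+ v) (fun x => u' x + v x) = sqdist u u'); last first.
  by apply: eq_integral => x _ /=; congr (_ ^+ 2)%:E; ring.
rewrite (_ : sqdist (fun x => u' x + v x) (u' \+ v') = sqdist v v'); last first.
  by apply: eq_integral => x _ /=; congr (_ ^+ 2)%:E; ring.
move=> /le_lt_trans; apply.
rewrite (_ : eps%:E = 2%:E * (eps / 4)%:E + 2%:E * (eps / 4)%:E)%E; last first.
  by rewrite -EFinM -EFinD; congr EFin; field.
by apply: lteD; rewrite lte_pmul2l.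
Qed.

Let approximableZ (c : R) u : approximable u -> approximable (fun x => c * u x).
Proof.
move=> [mu au]; split; first exact: measurable_funM.
(* The added 1 keeps the divisor positive when [c] is 0. *)
move=> eps e0; have c0 : 0 < c ^+ 2 + 1 by rewrite ltr_wpDl// sqr_ge0.
have [u' Vu' uu'] := au (eps / (c ^+ 2 + 1)) (divr_gt0 e0 c0).
have mu' := V_measurable _ Vu'.
exists (fun x => c * u' x); first exact: V_mul (V_cst c) Vu'.
rewrite /sqdist (_ : (\int[m]_x _ = (c ^+ 2)%:E * sqdist u u')%E); last first.
  rewrite -ge0_integralZl//; first last.
  - by rewrite lee_fin sqr_ge0.
  - by move=> x _; rewrite lee_fin sqr_ge0.
  - exact: measurable_sqdist.
  by apply: eq_integral => x _ /=; rewrite -EFinM; congr EFin; ring.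
have s0 : (0 <= sqdist u u')%E by apply: integral_ge0 => x _; rewrite lee_fin sqr_ge0.
apply: (@le_lt_trans _ _ ((c ^+ 2 + 1)%:E * sqdist u u')%E).
  by apply: lee_wpmul2r => //; rewrite lee_fin lerDl.
rewrite (_ : eps%:E = (c ^+ 2 + 1)%:E * (eps / (c ^+ 2 + 1))%:E)%E; last first.
  by rewrite -EFinM mulrC divfK// gt_eqF.
by rewrite lte_pmul2l.
Qed.

Let approximable_sum (I : Type) (s : seq I) (F : I -> T -> R) :
  (forall i, approximable (F i)) -> approximable (fun x => \sum_(i <- s) F i x).
Proof.
move=> aF; elim: s => [|i s IHs].
  by under eq_fun do rewrite big_nil; exact/approximable_V/V_cst.
by under eq_fun do rewrite big_cons; exact: approximableD.
Qed.

(* Pointwise limits of uniformly bounded sequences of V are stable under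
   products, which makes this class of sets closed under intersection. *)
Let limit_class : set (set T) := [set A | exists (w : nat -> T -> R) (C : R),
  [/\ forall n, V (w n), forall n x, `|w n x| <= C &
      forall x, w n x @[n --> \oo] --> (\1_A x : R)]].

Let limit_classI : setI_closed limit_class.
Proof.
move=> A B [w [C [Vw wC wA]]] [w' [C' [Vw' wC' wB]]].
exists (fun n x => w n x * w' n x), (C * C'); split.
- by move=> n; exact: V_mul.
- by move=> n x; rewrite normrM ler_pM.
- by move=> x; rewrite indicI; apply: cvgM.
Qed.

(** Once [f] is scaled into [-1, 1], the iterates of [sgn_step] on it stay in the algebra [V], stay
    bounded by 1, and converge to the sign of [f]. *)
Let limit_class_ge0 f : V f -> limit_class [set x | 0 <= f x].
Proof.
move=> Vf; have [C fC] := V_bounded _ Vf.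
have C1 : 0 < `|C| + 1 by rewrite ltr_wpDl.
pose g x := (`|C| + 1)^-1 * f x.
have g1 x : `|g x| <= 1.
  rewrite normrM normfV (gtr0_norm C1) mulrC ler_pdivrMr// mul1r.
  by rewrite (le_trans (fC x))// (le_trans (ler_norm _))// lerDl.
have Vs n : V (fun x => iter n sgn_step (g x)).
  elim: n => [|n IHn]; first exact: V_mul (V_cst _) Vf.
  rewrite (_ : (fun x => _) = fun x => iter n sgn_step (g x) * (3 / 2 + (- 2^-1) *
      (iter n sgn_step (g x) * iter n sgn_step (g x)))).
    by apply: V_mul => //; apply: V_add; [exact: V_cst|apply: V_mul; [exact: V_cst|exact: V_mul]].
  by apply/funext => x /=; rewrite /sgn_step; field.
(* The quadratic 1 + (t - t^2) / 2 takes the values 0, 1, 1 at -1, 0, 1, so it maps the sign of [f]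
   to the indicator; on [-1, 1] it is bounded by 2. *)
exists (fun n x => 1 + (2^-1 * iter n sgn_step (g x) +
  (- 2^-1) * (iter n sgn_step (g x) * iter n sgn_step (g x)))), 2; split.
- move=> n; apply: V_add; first exact: V_cst.
  by apply: V_add; apply: V_mul => //; exact: V_mul.
- move=> n x; have := iter_sgn_step_itv n _ (g1 x).
  move: (iter n sgn_step (g x)) => t; rewrite !ler_norml => /andP[t1 t2].
  by apply/andP; split; nra.
- move=> x; have cs := cvg_iter_sgn_step _ (g1 x).
  rewrite (_ : \1__ x = 1 + (2^-1 * Num.sg (g x) + - 2^-1 * (Num.sg (g x) * Num.sg (g x)))).
    apply: cvgD; first exact: cvg_cst.
    by apply: cvgD; apply: cvgM => //; do ?exact: cvg_cst; exact: cvgM.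
  rewrite indicE /g sgrM (gtr0_sg (x := (`|C| + 1)^-1)) ?invr_gt0// mul1r.
  case: (ltgtP 0 (f x)) => fx.
  + by rewrite mem_set ?gtr0_sg//=; do ?[exact: ltW|field].
  + by rewrite memNset ?ltr0_sg//=; do ?[by rewrite leNgt fx|field].
  + by rewrite -fx sgr0 mem_set ?mulr0 ?addr0//= -fx.
Qed.

(** The superlevel sets give one inclusion; for the other, an indicator that is a pointwise limit of
    measurable functions is measurable. *)
Let limit_class_generates : @measurable _ T = <<s limit_class >>.
Proof.
apply/seteqP; split.
  apply: (subset_trans V_generates); apply: smallest_sub; first exact: smallest_sigma_algebra.
  by move=> _ [f Vf ->]; apply: sub_sigma_algebra; exact: limit_class_ge0.
apply: smallest_sub; first exact: sigma_algebra_measurable.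
move=> A [w [C [Vw _ wA]]]; apply/measurable_indicP.
by apply: (measurable_fun_cvg (h := w)) => // n; exact: V_measurable.
Qed.

(** Dynkin induction from the intersection-stable class [limit_class]. Complements use the constant
    1, disjoint unions the partial sums of indicators. *)
Let approximable_indic A : measurable A -> approximable \1_A.
Proof.
move=> mA; have : <<s limit_class >> A by rewrite -limit_class_generates.
have bnd (C : R) : (\int[m]_x (C ^+ 2)%:E < +oo)%E.
  by rewrite integral_cst// ltey_eq fin_numM// fin_num_measure.
apply: (dynkin_induction (P := fun A => approximable \1_A)) => //.
- by rewrite indicT; exact: approximable_V (V_cst 1).
- move=> B BB; have [w [C [Vw wC wB]]] := BB.
  (* [C] bounds the sequence and 1 bounds the limiting indicator. *)
  apply: (@approximable_dominated w _ (cst (Num.max C 1))) => //.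
  + by move=> n; exact: approximable_V.
  + apply/measurable_indicP; rewrite limit_class_generates.
    exact: sub_sigma_algebra.
  + exact: bnd.
  + by move=> x; rewrite indicE; case: (_ \in _);
      rewrite ?normr1 ?normr0 le_max ?lexx ?ler01 orbT.
  + by move=> n x; rewrite (le_trans (wC n x))// le_max lexx.
- move=> B mB aB; rewrite (_ : \1_(~` B) = fun x => 1 + -1 * \1_B x).
    by apply: approximableD; [exact: approximable_V (V_cst 1)|exact: approximableZ].
  by apply/funext => x; rewrite !indicE in_setC; case: (_ \in _) => /=; ring.
- move=> F mF tF aF; pose w n x : R := \sum_(0 <= i < n) \1_(F i) x.
  (* By disjointness only the term of index [k] contributes, and it enters the sum at [n = k.+1]. *)
  have w_in k x n : F k x -> w n x = (k < n)%N%:R.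
    move=> Fkx; elim: n => [|n IHn]; first by rewrite /w big_nil.
    rewrite /w big_nat_recr//= -/(w n x) IHn indicE ltnS [in RHS]leq_eqVlt.
    have [<-|kn] := eqVneq k n; first by rewrite ltnn mem_set// add0r.
    rewrite memNset ?addr0// => Fnx; move/eqP: kn; apply.
    by apply: tF => //; exists x.
  have w_out x n : ~ (\bigcup_i F i) x -> w n x = 0.
    by move=> Fx; apply: big1 => i _; rewrite indicE memNset// => Fix; apply: Fx; exists i.
  apply: (@approximable_dominated w _ (cst 1)) => //.
  + by move=> n; exact: approximable_sum.
  + exact/measurable_indicP/bigcupT_measurable.
  + exact: bnd.
  + by move=> x; rewrite indicE; case: (_ \in _); rewrite ?normr1 ?normr0.
  + move=> n x; have [[k _ /w_in ->]|/w_out ->] := pselect ((\bigcup_i F i) x).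
      by case: (_ < _)%N; rewrite ?normr1 ?normr0.
    by rewrite normr0.
  + move=> x; rewrite indicE.
    have [Fx|Fx] := pselect ((\bigcup_i F i) x).
      rewrite mem_set//; have [k _ Fkx] := Fx.
      by apply: cvg_near_cst; exists k.+1 => // n /= kn; rewrite (w_in k)// kn.
    by rewrite memNset//; under eq_fun do rewrite w_out//; exact: cvg_cst.
Qed.

Import HBNNSimple.

Let approximable_nnsfun (f : {nnsfun T >-> R}) : approximable f.
Proof.
have := approximable_sum _ (finmap.enum_fset (fset_set (range f)))
  (fun y x => y * \1_(f @^-1` [set y]) x)
  (fun y => approximableZ y _ (approximable_indic _ (measurable_sfunP f (measurable_set1 y)))).
by congr approximable; apply/funext => x; rewrite fimfunE fsbig_finite.
Qed.

(** Simple functions increase to [u], so [u] itself serves as the dominating function. *)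
Let approximable_ge0 u : measurable_fun setT u -> (forall x, 0 <= u x) ->
  (\int[m]_x ((u x) ^+ 2)%:E < +oo)%E -> approximable u.
Proof.
move=> mu u0 iu; have mEu : measurable_fun setT (EFin \o u) by exact/measurable_EFinP.
pose w := nnsfun_approx measurableT mEu.
have wu x : w n x @[n --> \oo] --> u x.
  have /fine_cvgP[_] := @cvg_nnsfun_approx _ _ _ _ measurableT _ mEu
    (fun x _ => u0 x : (0%:E <= (EFin \o u) x)%E) x I.
  exact.
apply: (@approximable_dominated w u u) => //.
- by move=> x; rewrite ger0_norm.
- move=> n x; rewrite ger0_norm//.
  rewrite -(cvg_lim (@Rhausdorff R) (wu x)); apply: nondecreasing_cvgn_le.
    by move=> i j ij; have /lefP := nd_nnsfun_approx measurableT mEu ij; exact.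
  by apply/cvg_ex; exists (u x).
Qed.

Theorem algebra_density u : measurable_fun setT u ->
  (\int[m]_x ((u x) ^+ 2)%:E < +oo)%E -> approximable u.
Proof.
move=> mu iu; rewrite (_ : u = fun x => u^\+ x + -1 * u^\- x); last first.
  by apply/funext => x; rewrite mulN1r -[LHS]/(u x) -{1}(funrposBneg u).
have le_sq (g : T -> R) : measurable_fun setT g -> (forall x, 0 <= g x <= `|u x|) ->
    (\int[m]_x ((g x) ^+ 2)%:E < +oo)%E.
  move=> mg gu; apply: le_lt_trans iu; apply: ge0_le_integral => //.
  - by move=> x _; rewrite lee_fin sqr_ge0.
  - by apply/measurable_EFinP; exact: measurable_funX.
  - by apply/measurable_EFinP; exact: measurable_funX.
  - move=> x _; rewrite lee_fin -(real_normK (num_real (u x))).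
    by have /andP[? ?] := gu x; rewrite lerXn2r// nnegrE.
apply: approximableD.
  apply: approximable_ge0; [exact: measurable_funrpos|exact: funrpos_ge0|].
  apply: le_sq; first exact: measurable_funrpos.
  by move=> x; rewrite funrpos_ge0/= ge_max normr_ge0 ler_norm.
apply: approximableZ.
apply: approximable_ge0; [exact: measurable_funrneg|exact: funrneg_ge0|].
apply: le_sq; first exact: measurable_funrneg.
by move=> x; rewrite funrneg_ge0/= ge_max normr_ge0 -normrN ler_norm.
Qed.

End algebra_density.

(** * Orthogonality of the characters *)

Section restricted_integrals.
Context {d1 d2 : measure_display} {T1 : measurableType d1} {T2 : measurableType d2}.
Context {R : realType}.

(** The restricted measure gives no mass to the complement of [D] and agrees with [mu] on measurable
    subsets of [D]. *)
Lemma integral_mrestr (mu : {measure set T1 -> \bar R}) (D : set T1)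
    (mD : measurable D) (f : T1 -> \bar R) :
  (mrestr mu mD).-integrable setT f ->
  (\int[mrestr mu mD]_x f x = \int[mu]_(x in D) f x)%E.
Proof.
move=> fi; have D0 : mrestr mu mD (~` D) = 0%E by rewrite /mrestr setICl measure0.
rewrite (@negligible_integral _ _ _ (mrestr mu mD) _ _ _ (measurableC mD) measurableT fi D0).
rewrite setTD setCK; apply: eq_measure_integral => A mA AD.
by rewrite /= /mrestr; congr (mu _); apply/setIidPl.
Qed.

(** Fubini for [f] extended by 0 outside the rectangle; the extension splits into one restriction
    per variable. *)
Lemma integral_setX (m1 : {sigma_finite_measure set T1 -> \bar R})
    (m2 : {sigma_finite_measure set T2 -> \bar R}) (A : set T1) (B : set T2)
    (f : T1 * T2 -> \bar R) : measurable A -> measurable B ->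
  (m1 \x m2)%E.-integrable (A `*` B) f ->
  (\int[m1 \x m2]_(z in A `*` B) f z =
   \int[m2]_(y in B) \int[m1]_(x in A) f (x, y))%E.
Proof.
move=> mA mB fi; rewrite integral_mkcond -integral21_prod_meas1; last first.
  exact: (integrable_mkcond f (measurableX mA mB)).1.
rewrite [RHS]integral_mkcond; apply: eq_integral => y _; rewrite /fubini_G patchE.
case: ifPn => yB; last first.
  apply: integral0_eq => x _; rewrite patchE memNset// => -[_ /= By].
  by move: yB; rewrite mem_set.
rewrite [RHS]integral_mkcond; apply: eq_integral => x _; rewrite !patchE.
case: ifPn => [|xB]; first by rewrite inE => -[Ax _]; rewrite mem_set.
rewrite memNset// => Ax; move: xB; rewrite mem_set//; split => //.
by move: yB; rewrite inE.
Qed.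

End restricted_integrals.

(** * Integrals of cosines over the fundamental cell *)

Section trigonometric_integrals.
Context {R : realType}.
Local Notation tau := ((trigo.pi : R) *+ 2).

Lemma tau_gt0 : 0 < tau. Proof. by rewrite mulrn_wgt0 ?pi_gt0. Qed.

Lemma lebesgue_itv_tau : @lebesgue_measure R `[0%R, tau[%classic = tau%:E.
Proof. by rewrite lebesgue_measure_itv/= lte_fin tau_gt0 oppr0 adde0. Qed.

(** The primitive sin(k x + c) / k takes equal values at 0 and 2 pi, which is the imaginary part of
    [expiD2pi]. *)
Lemma integral_cos_itv (k : int) (c : R) : k != 0 ->
  (\int[@lebesgue_measure R]_(x in `[0%R, tau[) (cos (k%:~R * x + c))%:E = 0)%E.
Proof.
move=> k0; have k0' : k%:~R != 0 :> R by rewrite intr_eq0.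
have mc : measurable_fun setT (fun x : R => (cos (k%:~R * x + c))%:E).
  apply/measurable_EFinP; apply: (measurableT_comp (continuous_measurable_fun (@continuous_cos R))).
  by apply: measurable_funD => //; exact: measurable_funM.
rewrite integral_itv_bndo_bndc; last exact: measurable_funTS.
pose F x : R := sin (k%:~R * x + c) / k%:~R.
have dF (x : R) : is_derive x (1 : R) F (cos (k%:~R * x + c)).
  rewrite /F; apply: is_derive_eq.
  by rewrite !scaler0 add0r addr0 /GRing.scale/= mulr1; field.
have cF : continuous F.
  by move=> x; apply: differentiable_continuous; apply/derivable1_diffP; exact: ex_derive.
rewrite (@continuous_FTC2 _ _ F)//.
- rewrite /F mulr0 add0r; rewrite -[X in (X - _)%E]/(_)%:E.
  rewrite [k%:~R * tau + c]addrC (_ : k%:~R * tau = tau *~ k); last by rewrite mulrzl.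
  by have := expiD2pi c k => -[_ ->]; rewrite subee.
- exact: tau_gt0.
- apply: continuous_subspaceT => x; apply: continuous_comp; last exact: continuous_cos.
  by apply: cvgD; [apply: cvgM; [exact: cvg_cst|exact: cvg_id]|exact: cvg_cst].
- split; first by move=> x _; exact: ex_derive.
  + exact/cvg_at_right_filter/cF.
  + exact/cvg_at_left_filter/cF.
- by move=> x _; rewrite derive1E derive_val.
Qed.

Lemma dot_int_cons n (k : n.+1.-tuple int) (z : measurableTypeR R * n.-tuple R) :
  dot_int k (cons_pair z) = (thead k)%:~R * z.1 + dot_int [tuple of behead k] z.2.
Proof.
rewrite /dot_int big_ord_recl; congr (_ * _ + _).
by apply: eq_bigr => i _; rewrite tnthS; congr (_ * _); rewrite [in LHS](tuple_eta k) tnthS.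
Qed.

Lemma measurable_dot_int n (k : n.-tuple int) :
  measurable_fun setT (fun x : n.-tuple R => dot_int k x).
Proof.
apply: measurable_sum => i; apply: measurable_funM => //; exact: measurable_tnth.
Qed.

Lemma measurable_cos_dot_int n (k : n.-tuple int) (c : R) :
  measurable_fun setT (fun x : n.-tuple R => cos (dot_int k x + c)).
Proof.
apply: (measurableT_comp (continuous_measurable_fun (@continuous_cos R))).
by apply: measurable_funD => //; exact: measurable_dot_int.
Qed.

Lemma torus_cell_cons n : @cons_pair R n @^-1` @torus_cell R n.+1 =
  `[0%R, tau[%classic `*` @torus_cell R n.
Proof.
apply/seteqP; split => -[x t] /=.
  move=> xt; split; first by have := xt ord0; rewrite in_itv.
  by move=> i; have := xt (lift ord0 i); rewrite tnthS.
move=> [x0 tc] i; case: (unliftP ord0 i) => [j ->|->]; first by rewrite tnthS; exact: tc.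
by rewrite in_itv in x0.
Qed.

Lemma lebesgue_tuple_torus_cell n :
  lebesgue_tuple R n (@torus_cell R n) = (tau ^+ n)%:E.
Proof.
have := @lebesgue_tuple_box R n (fun=> `[0%R, tau[%classic) (fun=> measurable_itv _).
rewrite (_ : [set t | _] = @torus_cell R n); last first.
  by apply/seteqP; split => t /= ct i; have := ct i; rewrite in_itv.
move=> ->; rewrite (eq_bigr (fun=> tau%:E)); last first.
  by move=> i _; exact: lebesgue_itv_tau.
elim: n => [|n IHn]; first by rewrite big_ord0 expr0.
by rewrite big_ord_recl IHn exprS EFinM.
Qed.

(** Induction on the dimension, integrating the first coordinate first. If its frequency is nonzero
    the inner integral vanishes, the other coordinates being absorbed in the phase; otherwise it
    yields a factor 2 pi and a nonzero frequency remains in the tail. The phase [c] also covers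
    sines. *)
Lemma integral_cos_torus_cell n (k : n.-tuple int) (c : R) :
  (exists i, tnth k i != 0) ->
  (\int[lebesgue_tuple R n]_(x in @torus_cell R n) (cos (dot_int k x + c))%:E = 0)%E.
Proof.
elim: n k c => [k c [[]//]|n IHn k c [i ki]].
have mcell := @measurable_torus_cell R n.+1.
have mcell' := @measurable_torus_cell R n.
have fi : (@lebesgue_measure R \x lebesgue_tuple R n)%E.-integrable
    (`[0%R, tau[%classic `*` @torus_cell R n)
    (EFin \o (fun z => cos (dot_int k (cons_pair z) + c))).
  apply: measurable_bounded_integrable.
  - exact: measurableX.
  - have pm : (@lebesgue_measure R \x lebesgue_tuple R n)%E
        (`[0%R, tau[%classic `*` @torus_cell R n) = (tau * tau ^+ n)%:E.
      rewrite product_measure1E// EFinM.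
    exact: (congr2 mule lebesgue_itv_tau (lebesgue_tuple_torus_cell n)).
    apply: le_lt_trans (ltry (tau * tau ^+ n)); rewrite le_eqVlt.
    by apply/orP; left; apply/eqP; exact: pm.
  - apply: measurable_funTS.
    by apply: (measurableT_comp (measurable_cos_dot_int _ k c)).
  - exists 1; split => // M M1 z _; apply: le_trans (ltW M1).
    by rewrite /= ler_norml cos_geN1 cos_le1.
rewrite [LHS]/= (@integral_pushforward _ _ _ _ _ (@cons_pair R n)); first last.
- exact: mcell.
- by rewrite torus_cell_cons; exact: fi.
- by apply/measurable_EFinP; exact: measurable_cos_dot_int.
- exact: measurable_funPT.
rewrite torus_cell_cons integral_setX//.
under eq_integral do under eq_integral do rewrite /= dot_int_cons/= -addrA.
have [k0|k0] := eqVneq (thead k) 0; last first.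
  by apply: integral0_eq => t _; exact: integral_cos_itv.
under eq_integral do under eq_integral do rewrite k0 mul0r add0r.
rewrite (eq_integral (fun t =>
    tau%:E * (cos (dot_int [tuple of behead k] t + c))%:E)%E); last first.
  move=> t _; rewrite integral_cst//= muleC; congr (_ * _)%E.
  exact: lebesgue_itv_tau.
have ic : (lebesgue_tuple R n).-integrable (@torus_cell R n)
    (EFin \o (fun t => cos (dot_int [tuple of behead k] t + c))).
  apply: measurable_bounded_integrable => //.
  - by apply: le_lt_trans (ltry (tau ^+ n)); rewrite le_eqVlt; apply/orP;
      left; apply/eqP; exact: lebesgue_tuple_torus_cell.
  - by apply: measurable_funTS; exact: measurable_cos_dot_int.
  - exists 1; split => // M M1 z _; apply: le_trans (ltW M1).
    by rewrite /= ler_norml cos_geN1 cos_le1.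
rewrite integralZl// IHn ?mule0//.
case: (unliftP ord0 i) ki => [j ->|->]; last by rewrite -[tnth k ord0]/(thead k) k0 eqxx.
by rewrite [in tnth _ _](tuple_eta k) tnthS => kj; exists j.
Qed.

End trigonometric_integrals.

(** * Parseval's identity for a family of characters *)

Section character_family.
Context {disp : measure_display} {T : measurableType disp} {R : realType}.
Variable m : {finite_measure set T -> \bar R}.
Variables (K : choiceType) (e : K -> T -> R[i]).
Hypothesis mRe_e : forall k, measurable_fun setT (fun x => complex.Re (e k x)).
Hypothesis mIm_e : forall k, measurable_fun setT (fun x => complex.Im (e k x)).
Hypothesis norm_e : forall k x, normc (e k x) = 1.
Hypothesis ortho_e : forall k l, k != l -> cip m (e k) (e l) = 0.
Hypothesis one_e : exists k, forall x, e k x = 1.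
Hypothesis mul_e : forall k l, exists j, forall x, e k x * e l x = e j x.
Hypothesis conj_e : forall k, exists l, forall x, (e k x)^*%C = e l x.
Hypothesis gen_e : @measurable _ T `<=`
  <<s [set A | exists (k : K) (c : R[i]) (a : R),
         A = [set x | a <= complex.Re (c * e k x)]] >>.
Let M := fine (m setT).
Implicit Types (f g : T -> R[i]).

(** Indices may repeat in the list, so that a sum of polynomials is a concatenation. *)
Definition trigpoly f : Prop :=
  exists s : seq (R[i] * K), forall x, f x = \sum_(p <- s) p.1 * e p.2 x.

Let trigpolyD f g : trigpoly f -> trigpoly g -> trigpoly (fun x => f x + g x).
Proof.
by move=> [s fs] [t gt]; exists (s ++ t) => x; rewrite big_cat fs gt.
Qed.

Let trigpoly_family c k : trigpoly (fun x => c * e k x).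
Proof. by exists [:: (c, k)] => x; rewrite big_seq1. Qed.

Let trigpoly_sum (I : Type) (s : seq I) (F : I -> T -> R[i]) :
  (forall i, trigpoly (F i)) -> trigpoly (fun x => \sum_(i <- s) F i x).
Proof.
move=> tF; elim: s => [|i s IHs].
  by exists [::] => x; rewrite !big_nil.
by under eq_fun do rewrite big_cons; exact: trigpolyD.
Qed.

Let trigpolyM f g : trigpoly f -> trigpoly g -> trigpoly (fun x => f x * g x).
Proof.
move=> [s fs] [t gt]; under eq_fun do rewrite fs gt mulr_suml.
apply: trigpoly_sum => p; under eq_fun do rewrite mulr_sumr.
apply: trigpoly_sum => q; have [j ej] := mul_e p.2 q.2.
by under eq_fun do rewrite mulrACA ej; exact: trigpoly_family.
Qed.

Let trigpoly_cst c : trigpoly (fun=> c).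
Proof.
have [k ek] := one_e; have := trigpoly_family c k.
by under eq_fun do rewrite ek mulr1.
Qed.

(** Coefficients of equal indices are added up, giving the duplicate-free form required by the
    Bessel estimates. *)
Lemma trigpoly_uniq f : trigpoly f -> exists (s : seq K) (d : K -> R[i]),
  uniq s /\ forall x, f x = \sum_(k <- s) d k * e k x.
Proof.
move=> [s fs]; exists (undup (map snd s)), (fun k => \sum_(p <- s | p.2 == k) p.1).
split; first exact: undup_uniq.
move=> x; rewrite fs; under [RHS]eq_bigr do rewrite mulr_suml.
rewrite (exchange_big_dep predT)//= big_seq [RHS]big_seq; apply: eq_bigr => p ps.
rewrite big_mkcond (bigD1_seq p.2) ?undup_uniq ?mem_undup ?map_f//= eqxx.
by rewrite big1 ?addr0// => k /negbTE; rewrite eq_sym => ->.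
Qed.

Let V : set (T -> R) := [set r | trigpoly (fun x => (r x)%:C%C)].

(** The real part is half the sum of a number and its conjugate, and the family is stable under
    conjugation. *)
Let V_Re_family c k : V (fun x => complex.Re (c * e k x)).
Proof.
have [l el] := conj_e k.
have := trigpolyD _ _ (trigpoly_family (2^-1 * c) k) (trigpoly_family (2^-1 * c^*%C) l).
congr trigpoly; apply/funext => x; rewrite -el.
move: (e k x) => z; rewrite -!mulrA -mulrDr -rmorphM addcJ mulKf//.
Qed.

Let V_cst c : V (fun=> c). Proof. exact: trigpoly_cst. Qed.

Let V_add r s : V r -> V s -> V (fun x => r x + s x).
Proof.
move=> Vr Vs; rewrite /V/=; under eq_fun do rewrite rmorphD; exact: trigpolyD.
Qed.

Let V_mul r s : V r -> V s -> V (fun x => r x * s x).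
Proof.
move=> Vr Vs; rewrite /V/=; under eq_fun do rewrite rmorphM; exact: trigpolyM.
Qed.

Let V_bounded r : V r -> exists C, forall x, `|r x| <= C.
Proof.
move=> [s rs]; exists (\sum_(p <- s) normc p.1) => x.
rewrite (_ : `|r x| = normc (r x)%:C%C); last first.
  by rewrite /= expr0n/= addr0 sqrtr_sqr.
rewrite rs; elim: s {rs} => [|p s IHs]; first by rewrite !big_nil normc0.
by rewrite !big_cons (le_trans (le_normcD _ _))// lerD// normcM norm_e mulr1.
Qed.

Let V_measurable r : V r -> measurable_fun setT r.
Proof.
move=> [s rs]; rewrite (_ : r = fun x => \sum_(p <- s) complex.Re (p.1 * e p.2 x)).
  by apply: measurable_sum => p; have [] := sqint_scale_family m _ _ mRe_e mIm_e norm_e p.1 p.2.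
by apply/funext => x; rewrite -[LHS]/(complex.Re (r x)%:C%C) rs raddf_sum.
Qed.

Let V_generates :
  @measurable _ T `<=` <<s [set A | exists2 f, V f & A = [set x | 0 <= f x]] >>.
Proof.
apply: (subset_trans gen_e); apply: smallest_sub; first exact: smallest_sigma_algebra.
move=> _ [k [c [a ->]]]; apply: sub_sigma_algebra.
exists (fun x => complex.Re (c * e k x) + - a).
  by apply: V_add; [exact: V_Re_family|exact: V_cst].
by apply/seteqP; split => x /=; rewrite subr_ge0.
Qed.

(** The real and imaginary parts are approximated separately by real polynomials r and t; for r + i
    t the squared errors add up. *)
Let trigpoly_dense f (eps : R) : sqint m f -> 0 < eps -> exists2 g, trigpoly g &
  \int[m]_x normc (f x - g x) ^+ 2 < eps.
Proof.
move=> sf eps0; have [mr mi fi] := sf.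
have part (u : T -> R) : measurable_fun setT u -> (forall x, u x ^+ 2 <= normc (f x) ^+ 2) ->
    exists2 r, V r & (\int[m]_x ((u x - r x) ^+ 2)%:E < (eps / 2)%:E)%E.
  move=> mu uf; have [|_ h] := @algebra_density _ _ _ m V V_measurable V_bounded V_cst
    V_add V_mul V_generates u mu.
  - apply: le_lt_trans fi; apply: ge0_le_integral => //.
    + by move=> x _; rewrite lee_fin sqr_ge0.
    + by apply/measurable_EFinP; exact: measurable_funX.
    + by apply/measurable_EFinP; exact: measurable_sqr_normc.
    + by move=> x _; rewrite lee_fin.
  - by apply: h; rewrite divr_gt0.
have [|r Vr dr] := part _ mr.
  by move=> x; rewrite sqr_normc lerDl sqr_ge0.
have [|t Vt dt] := part _ mi.
  by move=> x; rewrite sqr_normc lerDr sqr_ge0.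
exists (fun x => (r x)%:C%C + (0 +i* 1)%C * (t x)%:C%C).
  by apply: trigpolyD => //; apply: trigpolyM.
have E : (\int[m]_x (normc (f x - ((r x)%:C%C + (0 +i* 1)%C * (t x)%:C%C)) ^+ 2)%:E =
    \int[m]_x ((complex.Re (f x) - r x) ^+ 2)%:E +
    \int[m]_x ((complex.Im (f x) - t x) ^+ 2)%:E)%E.
  rewrite -ge0_integralD//.
  - apply: eq_integral => x _; rewrite -EFinD; congr EFin; rewrite sqr_normc.
    by case: (f x) => a b /=; ring.
  - by move=> x _; rewrite lee_fin sqr_ge0.
  - apply/measurable_EFinP/measurable_funX/measurable_funB => //.
    exact: V_measurable.
  - by move=> x _; rewrite lee_fin sqr_ge0.
  - apply/measurable_EFinP/measurable_funX/measurable_funB => //.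
    exact: V_measurable.
have lt : (\int[m]_x (normc (f x - ((r x)%:C%C + (0 +i* 1)%C * (t x)%:C%C)) ^+ 2)%:E < eps%:E)%E.
  by rewrite E (splitr eps) EFinD lteD.
rewrite /Rintegral -lte_fin fineK// ge0_fin_numE ?(lt_trans lt) ?ltry//.
by apply: integral_ge0 => x _; rewrite lee_fin sqr_ge0.
Qed.

(** Bessel's inequality on finite subsets bounds the sum from above. From below,
    [le_bessel_remainder] is applied to a trigonometric polynomial within [eps / M] of [f], the
    remainder being multiplied by [M]. *)
Theorem parseval_family f : sqint m f -> 0 < M ->
  \esum_(k in [set: K]) (normc (cip m f (e k)) ^+ 2)%:E =
  (M%:E * \int[m]_x (normc (f x) ^+ 2)%:E)%E.
Proof.
move=> sf M0; have Ef : (\int[m]_x (normc (f x) ^+ 2)%:E)%E =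
    (\int[m]_x normc (f x) ^+ 2)%:E.
  by rewrite /Rintegral fineK//; apply: integrable_fin_num => //; exact: sqint_integrable.
rewrite Ef -EFinM; apply/eqP; rewrite eq_le; apply/andP; split.
  apply: ge_ereal_sup => _ [F [finF _] <-].
  rewrite fsbig_finite//= sumEFin lee_fin.
  by apply: (bessel m K e) => //; exact: finmap.fset_uniq.
apply/lee_addgt0Pr => eps eps0.
have [|g tg dg] := trigpoly_dense _ (eps / M) sf; first by rewrite divr_gt0.
have [s [d [us gs]]] := trigpoly_uniq _ tg.
have := le_bessel_remainder m K e mRe_e mIm_e norm_e ortho_e f d s sf us M0.
rewrite -lee_fin => /le_trans; apply; rewrite EFinD; apply: leeD.
  apply: esum_ge; exists [set` s] => //; by rewrite -fsbig_seq//= sumEFin.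
rewrite lee_fin mulrC -ler_pdivlMr// ltW//; move: dg.
by under eq_Rintegral do rewrite gs.
Qed.

End character_family.

(** * Fourier series on the torus *)

(** One inequality comes from finite sums; the converse is the same inequality for the factor
    [c^-1]. *)
Lemma esum_scale {R : realType} {I : choiceType} (c : R) (a : I -> \bar R) :
  0 < c -> (forall i, 0 <= a i)%E ->
  (\esum_(i in [set: I]) (c%:E * a i) = c%:E * \esum_(i in [set: I]) a i)%E.
Proof.
have le (r : R) (b : I -> \bar R) : 0 < r -> (forall i, 0 <= b i)%E ->
    (\esum_(i in [set: I]) (r%:E * b i) <= r%:E * \esum_(i in [set: I]) b i)%E.
  move=> r0 b0; apply: ge_ereal_sup => _ [F [finF _] <-].
  rewrite fsbig_finite//= -ge0_sume_distrr//.
  apply: lee_wpmul2l; first by rewrite lee_fin ltW.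
  by apply: esum_ge; exists F => //; rewrite fsbig_finite.
move=> c0 a0; apply/eqP; rewrite eq_le le//=.
have ca i : (a i = c^-1%:E * (c%:E * a i))%E by rewrite muleA -EFinM mulVf ?gt_eqF// mul1e.
under [X in (_ * X <= _)%E]eq_esum do rewrite ca.
apply: (@le_trans _ _ (c%:E * (c^-1%:E * \esum_(i in [set: I]) (c%:E * a i)))%E).
  apply: lee_wpmul2l; first by rewrite lee_fin ltW.
  by apply: le; rewrite ?invr_gt0// => i; rewrite mule_ge0// lee_fin ltW.
by rewrite muleA -EFinM mulfV ?gt_eqF// mul1e.
Qed.

Section torus_parseval.
Variables (R : realType) (n : nat).
Local Notation tau := ((trigo.pi : R) *+ 2).
Local Notation mT := (@torus_measure R n).

Lemma torus_measureT : mT setT = (tau ^+ n)%:E.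
Proof.
rewrite /torus_measure /pushforward preimage_setT /mrestr setTI.
exact: lebesgue_tuple_torus_cell.
Qed.

Let torus_measure_finite : fin_num_fun mT.
Proof.
move=> A mA; rewrite ge0_fin_numE//; apply: (@le_lt_trans _ _ (mT setT)).
  by apply: le_measure; rewrite ?inE.
by rewrite torus_measureT ltry.
Qed.

HB.instance Definition _ :=
  Measure_isFinite.Build _ (torus R n) R mT torus_measure_finite.

(** The universal property of the quotient sigma-algebra. *)
Lemma measurable_fun_torus {disp} {T : measurableType disp} (g : torus R n -> T) :
  measurable_fun setT (g \o @torus_proj R n) -> measurable_fun setT g.
Proof.
move=> mg _ A mA; rewrite setTI.
by have := mg measurableT A mA; rewrite setTI.
Qed.

Lemma torus_projK (x : torus R n) : torus_proj (repr x) = x.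
Proof. exact: reprK. Qed.

Lemma measurable_Re_fourier_char (k : n.-tuple int) :
  measurable_fun setT (fun x : torus R n => complex.Re (fourier_char k x)).
Proof.
apply: measurable_fun_torus; rewrite (_ : _ \o _ = fun x => cos (dot_int k x + 0)).
  exact: measurable_cos_dot_int.
by apply/funext => x; rewrite /comp fourier_char_proj /= addr0.
Qed.

Lemma measurable_Im_fourier_char (k : n.-tuple int) :
  measurable_fun setT (fun x : torus R n => complex.Im (fourier_char k x)).
Proof.
apply: measurable_fun_torus.
rewrite (_ : _ \o _ = fun x => - cos (dot_int k x + trigo.pi / 2)).
  by apply: measurable_funN; exact: measurable_cos_dot_int.
by apply/funext => x; rewrite /comp fourier_char_proj /= cosDpihalf opprK.
Qed.

Lemma normc_expi (t : R) : normc (expi t) = 1.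
Proof. by rewrite /= cos2Dsin2 sqrtr1. Qed.

Lemma normc_fourier_char (k : n.-tuple int) (x : torus R n) :
  normc (fourier_char k x) = 1.
Proof. exact: normc_expi. Qed.

(** Change of variables along the projection reduces the integral to the fundamental cell. *)
Lemma Rintegral_torus_cos (k : n.-tuple int) (c : R) (g : torus R n -> R) :
  (exists i, tnth k i != 0) ->
  (forall x, g (torus_proj x) = cos (dot_int k x + c)) ->
  \int[mT]_x g x = 0.
Proof.
move=> k0 gE.
have mg : measurable_fun setT g.
  apply: measurable_fun_torus; rewrite (_ : _ \o _ = fun x => cos (dot_int k x + c)).
    exact: measurable_cos_dot_int.
  by apply/funext => x; rewrite -gE.
have ig : (mrestr (lebesgue_tuple R n) (@measurable_torus_cell R n)).-integrable setT
    ((EFin \o g) \o @torus_proj R n).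
  apply: measurable_bounded_integrable => //.
  - apply: le_lt_trans (ltry (tau ^+ n)); rewrite le_eqVlt; apply/orP; left; apply/eqP.
    by rewrite /= /mrestr setTI; exact: lebesgue_tuple_torus_cell.
  - exists 1; split => // M M1 x _; apply: le_trans (ltW M1).
    by rewrite /= gE ler_norml cos_geN1 cos_le1.
rewrite /Rintegral (@integral_pushforward _ _ _ _ _ (@torus_proj R n)); first last.
- exact: measurableT.
- by rewrite preimage_setT; exact: ig.
- exact/measurable_EFinP.
- exact: measurable_funPT.
rewrite preimage_setT (integral_mrestr _ _ _ _ ig).
under eq_integral do rewrite /= gE.
by rewrite integral_cos_torus_cell.
Qed.

Lemma dot_intB (k l : n.-tuple int) (x : n.-tuple R) :
  dot_int [tuple tnth k i - tnth l i | i < n] x = dot_int k x - dot_int l x.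
Proof.
rewrite /dot_int -sumrB; apply: eq_bigr => i _.
by rewrite tnth_mktuple rmorphB mulrBl.
Qed.

(** The real part of the integrand is cos((k - l).x); the imaginary part sin((k - l).x) is written
    cos((l - k).x + pi / 2), hence the exchanged indices. *)
Lemma fourier_char_ortho (k l : n.-tuple int) : k != l ->
  cip mT (fourier_char k) (fourier_char l) = 0.
Proof.
move=> kl; have dk (j j' : n.-tuple int) : j != j' ->
    exists i, tnth [tuple tnth j i - tnth j' i | i < n] i != 0.
  move=> jj'; apply/existsP; apply: contraNT jj'; rewrite negb_exists => /forallP h.
  by apply/eqP/eq_from_tnth => i; have := h i; rewrite negbK tnth_mktuple subr_eq0 => /eqP.
rewrite /cip; congr (_ +i* _)%C.
  apply: (@Rintegral_torus_cos _ 0 _ (dk _ _ kl)) => x.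
  by rewrite !fourier_char_proj ReMconj/= dot_intB addr0 cosB.
apply: (@Rintegral_torus_cos _ (trigo.pi / 2) _ (dk l k _)); first by rewrite eq_sym.
move=> x; rewrite !fourier_char_proj ImMconj/= dot_intB cosDpihalf sinB.
by ring.
Qed.

Lemma expiD (s t : R) : expi s * expi t = expi (s + t).
Proof. by apply/eqP; rewrite eq_complex /= cosD sinD; apply/andP; split; apply/eqP; ring. Qed.

Lemma conj_expi (s : R) : (expi s)^*%C = expi (- s).
Proof. by rewrite /expi cosN sinN. Qed.

Lemma fourier_char_one : exists k : n.-tuple int, forall x : torus R n, fourier_char k x = 1.
Proof.
exists [tuple 0 | i < n] => x; rewrite /fourier_char.
rewrite (_ : dot_int _ _ = 0); first by rewrite /expi cos0 sin0.
by apply: big1 => i _; rewrite tnth_mktuple mul0r.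
Qed.

Lemma fourier_charM (k l : n.-tuple int) : exists j : n.-tuple int,
  forall x : torus R n, fourier_char k x * fourier_char l x = fourier_char j x.
Proof.
exists [tuple tnth k i + tnth l i | i < n] => x; rewrite /fourier_char expiD.
congr expi; rewrite /dot_int -big_split; apply: eq_bigr => i _.
by rewrite tnth_mktuple rmorphD mulrDl.
Qed.

Lemma fourier_char_conj (k : n.-tuple int) : exists l : n.-tuple int,
  forall x : torus R n, (fourier_char k x)^*%C = fourier_char l x.
Proof.
exists [tuple - tnth k i | i < n] => x; rewrite /fourier_char conj_expi.
congr expi; rewrite /dot_int -sumrN; apply: eq_bigr => i _.
by rewrite tnth_mktuple rmorphN mulNr.
Qed.

(** * Generation of the sigma-algebra of the torus by the characters *)

Definition torus_red (t : R) : R := t - tau *~ Num.floor (t / tau).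

Lemma torus_red_itv t : 0 <= torus_red t < tau.
Proof.
have tau0 := @tau_gt0 R; have := Num.Theory.floor_itv (t / tau).
rewrite ler_pdivlMr// ltr_pdivrMr// intrD mulrDl mul1r /torus_red -[tau *~ _]mulrzl => /andP[h1 h2].
by rewrite subr_ge0 h1 ltrBlDl.
Qed.

Definition torus_sec (x : torus R n) : n.-tuple R :=
  [tuple torus_red (tnth (repr x) i) | i < n].

Lemma torus_secK (x : torus R n) : torus_proj (torus_sec x) = x.
Proof.
rewrite -[RHS]torus_projK; apply/eqP.
rewrite /torus_proj (eqmodE (torus_equiv R n)); apply/forallP => i.
rewrite tnth_mktuple /torus_red addrAC subrr add0r -[tau *~ _]mulrzl mulNr -mulrA divff.
  by rewrite mulr1 rpredN intr_int.
by rewrite gt_eqF// tau_gt0.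
Qed.

(* Makes the coordinate rays of the fundamental cell superlevel sets of
   trigonometric polynomials. *)
Lemma le_cosB_half (t a : R) : 0 <= t < tau -> 0 <= a < tau ->
  (cos (a / 2) <= cos (t - a / 2)) = (t <= a).
Proof.
move=> /andP[t0 t1] /andP[a0 a1]; have p0 := pi_gt0 R.
have a2 : a / 2 \in `[0, trigo.pi] by rewrite in_itv/=; apply/andP; split; lra.
case: (leP t a) => ta.
  rewrite -(cos_norm (t - a / 2)) leNgt ltr_cos ?in_itv/= ?normr_ge0//.
    by rewrite -leNgt ler_norml; apply/andP; split; lra.
  by rewrite ler_norml; apply/andP; split; lra.
apply/negbTE; rewrite -ltNge; case: (leP (t - a / 2) trigo.pi) => tp.
  rewrite ltr_cos// ?in_itv/=; last by apply/andP; split; lra.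
  by lra.
(* Past pi, the angle s = t - a / 2 is reflected to 2 pi - s, which lies between a / 2 and pi, where
   cosine decreases. *)
rewrite -(cosN (t - a / 2)) -(@cosD2pi R (- (t - a / 2))).
rewrite ltr_cos// ?in_itv/=; last by apply/andP; split; lra.
by lra.
Qed.

(** The section [torus_sec] is measurable for the generated sigma-algebra, and every set is the
    preimage under it of its own preimage under the projection. *)
Lemma torus_generated : @measurable _ (torus R n) `<=`
  <<s [set A | exists (k : n.-tuple int) (c : R[i]) (a : R),
         A = [set x | a <= complex.Re (c * fourier_char k x)]] >>.
Proof.
set G := [set A | _].
have msec : measurable_fun setT (torus_sec : g_sigma_algebraType G -> n.-tuple R).
  apply/measurable_fun_tnthP => i.
  apply: (measurability _ (RGenOInfty.measurableE R)) => _ [_ [a ->] <-].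
  rewrite setTI; set B := _ @^-1` _.
  suff : measurable (~` B) by move=> /measurableC; rewrite setCK.
  have BE : ~` B = [set x : torus R n | tnth (torus_sec x) i <= a].
    apply/seteqP; split => x /=; rewrite /B/= in_itv/= andbT.
      by move=> /negP; rewrite -leNgt.
    by move=> xa; apply/negP; rewrite -leNgt.
  have sec_itv x : 0 <= tnth (torus_sec x) i < tau.
    by rewrite tnth_mktuple; exact: torus_red_itv.
  (* Coordinates of the section lie in [0, 2 pi), so thresholds outside this interval give the empty
     or the full set. *)
  case: (ltP a 0) => a0.
    rewrite (_ : ~` B = set0); first exact: measurable0.
    rewrite BE; apply/seteqP; split => // x /=; have /andP[s0 _] := sec_itv x.
    by move=> /(le_trans s0); rewrite leNgt a0.
  case: (leP tau a) => a1.
    rewrite (_ : ~` B = setT); first exact: measurableT.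
    rewrite BE; apply/seteqP; split => // x _ /=; have /andP[_ s1] := sec_itv x.
    exact: le_trans (ltW s1) a1.
  apply: sub_sigma_algebra.
  (* The character of the i-th unit vector, rotated by -a / 2, has real part cos(t - a / 2), where t
     is the i-th coordinate; [le_cosB_half] then applies. *)
  exists [tuple (j == i)%:Z | j < n], (expi (- (a / 2))), (cos (a / 2)).
  have charE x : complex.Re (expi (- (a / 2)) *
      fourier_char [tuple (j == i)%:Z | j < n] x) = cos (tnth (torus_sec x) i - a / 2).
    rewrite -{1}(torus_secK x) fourier_char_proj expiD [LHS]/=; congr cos.
    rewrite addrC; congr (_ - _); rewrite /dot_int (bigD1 i)//= tnth_mktuple eqxx mul1r.
    rewrite big1 ?addr0// => j /negbTE ji.
    by rewrite tnth_mktuple ji mul0r.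
  rewrite BE; apply/seteqP; split => x; rewrite /mkset charE le_cosB_half ?a0//.
move=> A mA.
have -> : A = torus_sec @^-1` (@torus_proj R n @^-1` A).
  by apply/seteqP; split => x /=; rewrite torus_secK.
have := msec measurableT _ mA; rewrite setTI; exact.
Qed.

(** [coef] is [tau ^- n] times [cip]; once squared, this factor turns the [tau ^+ n] of
    [parseval_family] into [tau ^- n]. *)
Theorem parseval_torus (f : torus R n -> R[i]) : L2 f ->
  \esum_(k in [set: n.-tuple int]) (normc (coef f (fourier_char k)) ^+ 2)%:E =
  ((tau ^- n)%:E * L2normsq f)%E.
Proof.
move=> f2.
have M0 : 0 < fine (mT setT) by rewrite torus_measureT/= exprn_gt0// tau_gt0.
(* torus_integral (f * conj g) is cip mT f g by conversion. *)
have P : \esum_(k in [set: n.-tuple int]) (normc (cip mT f (fourier_char k)) ^+ 2)%:E =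
    ((tau ^+ n)%:E * L2normsq f)%E.
  have := @parseval_family _ _ _ mT _ _ measurable_Re_fourier_char
    measurable_Im_fourier_char normc_fourier_char fourier_char_ortho fourier_char_one
    fourier_charM fourier_char_conj torus_generated f f2 M0.
  by move=> ->; congr (_%:E * _)%E; exact: (congr1 fine torus_measureT).
have tn0 : 0 < tau ^+ n by rewrite exprn_gt0// tau_gt0.
under eq_esum do rewrite /coef normcM exprMn EFinM.
rewrite esum_scale; first last.
- by move=> k; rewrite lee_fin sqr_ge0.
- by rewrite /= expr0n/= addr0 sqrtr_sqr gtr0_norm ?invr_gt0//; apply: exprn_gt0; rewrite invr_gt0.
rewrite [X in (_ * X)%E]P muleA -EFinM; congr (_%:E * _)%E.
rewrite /= expr0n/= addr0 sqrtr_sqr ger0_norm; last by rewrite invr_ge0 ltW.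
have : tau ^+ n != 0 by rewrite (gt_eqF tn0).
by move: (tau ^+ n) => t t0; field.
Qed.

End torus_parseval.

(** * The learnable basis *)

Section countable_esum.
Context {disp : measure_display} {T : measurableType disp} {R : realType}.

(** Reindexing by codes, with value 0 at integers that encode nothing. As a series, the sum inherits
    measurability from its terms. *)
Lemma esum_pickle (I : countType) (a : I -> \bar R) : (forall i, 0 <= a i)%E ->
  \esum_(i in [set: I]) a i = (\sum_(j <oo | j \in predT) oapp a 0 (@pickle_inv I j))%E.
Proof.
move=> a0; have b0 j : (0 <= oapp a 0 (@pickle_inv I j))%E by case: pickle_inv.
rewrite nneseries_esumT// (esumID (range (@pickle I)))//.
rewrite [X in (_ + X)%E]esum1 ?adde0; last first.
  move=> j [_ Ij]; case E : (@pickle_inv I j) => [i|//]; exfalso; apply: Ij.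
  by exists i => //; have := @pickle_invK I j; rewrite /ocancel/= E.
rewrite setTI (reindex_esum [set: I] _ (@pickle I)); last first.
  split; [by move=> i _; exists i| |by move=> _ [i _ <-]; exists i].
  by move=> i j _ _; exact: (pcan_inj (@pickleK_inv I)).
by apply: eq_esum => i _; rewrite pickleK_inv.
Qed.

Lemma measurable_fun_esum (I : countType) (a : T -> I -> \bar R) :
  (forall x i, 0 <= a x i)%E -> (forall i, measurable_fun setT (a ^~ i)) ->
  measurable_fun setT (fun x => \esum_(i in [set: I]) a x i).
Proof.
move=> a0 ma; under eq_fun do rewrite esum_pickle//.
apply: ge0_emeasurable_sum => [j x _ _|j _]; first by case: pickle_inv => /=.
case: (@pickle_inv I j) => [i|]; first exact: ma.
exact: measurable_cst.
Qed.

End countable_esum.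

(** Tonelli applies to the positive and negative parts; subtraction and [fine] preserve
    measurability on the extended reals, so sections with infinite integral are covered. *)
Lemma measurable_Rintegral_section {d1 d2 : measure_display}
    {T1 : measurableType d1} {T2 : measurableType d2} {R : realType}
    (m1 : {sigma_finite_measure set T1 -> \bar R}) (F : T1 * T2 -> R) :
  measurable_fun setT F -> measurable_fun setT (fun y => \int[m1]_x F (x, y)).
Proof.
move=> mF; rewrite /Rintegral.
apply: (measurableT_comp (fine_measurable measurableT)).
have mE : measurable_fun setT (EFin \o F) by exact/measurable_EFinP.
rewrite (_ : (fun y => _) = fun y => (\int[m1]_x ((EFin \o F)^\+ (x, y)) -
    \int[m1]_x ((EFin \o F)^\- (x, y)))%E); last first.
  by apply/funext => y; rewrite integralE; congr (_ - _)%E; apply: eq_integral => x _;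
    rewrite ?funeposE ?funenegE.
apply: emeasurable_funB.
  apply: (@measurable_fun_fubini_tonelli_G _ _ _ _ _ m1 (EFin \o F)^\+%E) => //.
  exact: measurable_funepos.
apply: (@measurable_fun_fubini_tonelli_G _ _ _ _ _ m1 (EFin \o F)^\-%E) => //.
exact: measurable_funeneg.
Qed.

(** The weight is real, hence equal to its conjugate, and moves from the basis function to [f]. *)
Lemma coef_learnable_basis_fourier {R : realType} {d : nat} {chi : Type}
    (p : torus R d * chi -> R) (f : torus R d -> R[i]) k y :
  coef f (learnable_basis p k y) =
  coef (fun x => (Num.sqrt (p (x, y)))%:C%C * f x) (fourier_char k).
Proof.
rewrite /coef; congr (_ * torus_integral _); apply/funext => x.
rewrite /learnable_basis; case: (f x) (fourier_char k x) => [a b] [u v].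
by apply/eqP; rewrite eq_complex /=; apply/andP; split; apply/eqP; ring.
Qed.

(** * Integration of Parseval's identity over the parameter y *)

Section weighted_frame.
Context {R : realType} {d : nat} {disp : measure_display} {chi : measurableType disp}.
Variables (mu : {sigma_finite_measure set chi -> \bar R}) (p : torus R d * chi -> R).
Hypothesis mp : measurable_fun setT p.
Hypothesis p0 : forall z, 0 <= p z.
Hypothesis p1 : forall x, (\int[mu]_y (p (x, y))%:E = 1)%E.
Local Notation tau := ((trigo.pi : R) *+ 2).
Variable f : torus R d -> R[i].
Hypothesis f2 : L2 f.

Let g y x : R[i] := (Num.sqrt (p (x, y)))%:C%C * f x.

Let mRe : measurable_fun setT (fun x => complex.Re (f x)). Proof. by case: f2. Qed.
Let mIm : measurable_fun setT (fun x => complex.Im (f x)). Proof. by case: f2. Qed.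

Let measurable_sqrtp : measurable_fun setT (fun z => Num.sqrt (p z)).
Proof.
exact: (measurableT_comp (continuous_measurable_fun (@sqrt_continuous R))).
Qed.

Let ReM (r : R) (z : R[i]) : complex.Re (r%:C%C * z) = r * complex.Re z.
Proof. by case: z => a b /=; rewrite mul0r subr0. Qed.

Let ImM (r : R) (z : R[i]) : complex.Im (r%:C%C * z) = r * complex.Im z.
Proof. by case: z => a b /=; rewrite mul0r addr0. Qed.

Let measurable_Re_joint :
  measurable_fun setT (fun z : torus R d * chi => complex.Re (g z.2 z.1)).
Proof.
rewrite /g; under eq_fun do rewrite ReM -surjective_pairing.
apply: measurable_funM => //; exact: (measurableT_comp mRe).
Qed.

Let measurable_Im_joint :
  measurable_fun setT (fun z : torus R d * chi => complex.Im (g z.2 z.1)).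
Proof.
rewrite /g; under eq_fun do rewrite ImM -surjective_pairing.
apply: measurable_funM => //; exact: (measurableT_comp mIm).
Qed.

Let h z : \bar R := (normc (g z.2 z.1) ^+ 2)%:E.

Let hE x y : h (x, y) = ((normc (f x) ^+ 2)%:E * (p (x, y))%:E)%E.
Proof.
rewrite /h/= /g normcM exprMn -EFinM mulrC; congr (_ * _)%:E.
by rewrite sqr_normc/= expr0n/= addr0 sqr_sqrtr.
Qed.

Let mh : measurable_fun setT h.
Proof.
apply/measurable_EFinP.
exact: (measurable_sqr_normc (fun z => g z.2 z.1)).
Qed.

Let h0 z : (0 <= h z)%E. Proof. by rewrite lee_fin sqr_ge0. Qed.

Let L2normsq_ge0 y : (0 <= L2normsq (g y))%E.
Proof. by apply: integral_ge0 => x _; rewrite lee_fin sqr_ge0. Qed.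

Let measurable_L2normsq : measurable_fun setT (fun y => L2normsq (g y)).
Proof.
exact: (@measurable_fun_fubini_tonelli_G _ _ _ _ _ (@torus_measure R d) _ mh h0).
Qed.

(** Tonelli exchanges the integrals, and [p1] integrates the weight to 1 at each point of the
    torus. *)
Let integral_L2normsq : (\int[mu]_y L2normsq (g y) = L2normsq f)%E.
Proof.
rewrite /L2normsq; have /= <- := @fubini_tonelli _ _ _ _ _ (@torus_measure R d) mu h mh h0.
apply: eq_integral => x _; under eq_integral do rewrite hE.
rewrite ge0_integralZl//.
- by rewrite p1 mule1.
- by apply/measurable_EFinP; exact: (measurableT_comp mp).
- by move=> y _; rewrite lee_fin.
- by rewrite lee_fin sqr_ge0.
Qed.

(** The squared norm of [g y] has a finite integral over y, so it is finite almost everywhere. *)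
Lemma ae_L2_weighted : {ae mu, forall y, L2 (g y)}.
Proof.
have : mu.-integrable setT (fun y => L2normsq (g y)).
  apply/integrableP; split; first exact: measurable_L2normsq.
  under eq_integral do rewrite gee0_abs ?L2normsq_ge0//.
  by rewrite integral_L2normsq; case: f2.
move=> /(integrable_ae measurableT); apply: filterS => y /(_ I) fin; split.
- exact: (measurable_fun_pair1 y measurable_Re_joint).
- exact: (measurable_fun_pair1 y measurable_Im_joint).
- by rewrite ltey_eq fin.
Qed.

Lemma parseval_weighted :
  (\int[mu]_y (\esum_(k in [set: d.-tuple int])
     (normc (coef f (learnable_basis p k y)) ^+ 2)%:E) =
   (tau ^- d)%:E * L2normsq f)%E.
Proof.
rewrite -integral_L2normsq -ge0_integralZl//; last first.
- by rewrite lee_fin invr_ge0 exprn_ge0// ltW// tau_gt0.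
(* Parseval's identity is available for almost every y; comparing the integrals through an almost
   everywhere equality asks for the measurability of both integrands. *)
apply: ge0_ae_eq_integral => //.
- apply: measurable_fun_esum => [y k|k]; first by rewrite lee_fin sqr_ge0.
  apply/measurable_EFinP.
  under eq_fun do rewrite coef_learnable_basis_fourier /coef normcM exprMn
    (sqr_normc (torus_integral _)).
  apply: measurable_funM => //.
  have mRek : measurable_fun setT
      (fun z : torus R d * chi => complex.Re (fourier_char k z.1)).
    by apply: (measurableT_comp (measurable_Re_fourier_char _ _ k)).
  have mImk : measurable_fun setT
      (fun z : torus R d * chi => complex.Im (fourier_char k z.1)).
    by apply: (measurableT_comp (measurable_Im_fourier_char _ _ k)).
  apply: measurable_funD; apply: measurable_funX.
  + apply: (measurable_Rintegral_section (@torus_measure R d)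
      (fun z => complex.Re (g z.2 z.1 * (fourier_char k z.1)^*%C))).
    exact: measurable_ReMconj.
  + apply: (measurable_Rintegral_section (@torus_measure R d)
      (fun z => complex.Im (g z.2 z.1 * (fourier_char k z.1)^*%C))).
    exact: measurable_ImMconj.
- exact: measurable_funeM.
- by move=> y _; apply: esum_ge0 => k _; rewrite lee_fin sqr_ge0.
- by move=> y _; rewrite mule_ge0// lee_fin invr_ge0 exprn_ge0// ltW// tau_gt0.
apply: filterS ae_L2_weighted => y gy _.
under eq_esum do rewrite coef_learnable_basis_fourier.
exact: parseval_torus.
Qed.

End weighted_frame.

Local Open Scope ereal_scope.

(** The first conjunct ensures that the coefficients are genuine integrals for almost every y; on
    the remaining null set, [coef] may take a default value. *)
Theorem theorem5 (R : realType) (d : nat) (disp : measure_display)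
    (chi : measurableType disp) (mu : {sigma_finite_measure set chi -> \bar R})
    (p : torus R d * chi -> R) :
  (1 <= d)%N ->
  measurable_fun setT p ->
  (forall z, (0 <= p z)%R) ->
  (forall x, \int[mu]_y (p (x, y))%:E = 1) ->
  [/\ (forall f : torus R d -> R[i], L2 f ->
         {ae mu, forall y, L2 (fun x => (Num.sqrt (p (x, y)))%:C%C * f x)%R}),
      (exists A B : R, [/\ (0 < A)%R, (A <= B)%R &
         forall f : torus R d -> R[i], L2 f ->
           A%:E * L2normsq f <=
             (\int[mu]_y (\esum_(k in [set: d.-tuple int])
               (normc (coef f (learnable_basis p k y)) ^+ 2)%:E))
             <= B%:E * L2normsq f]) &
      (forall f : torus R d -> R[i], L2 f ->
         ((trigo.pi *+ 2) ^- d)%:E * L2normsq f =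
           (\int[mu]_y (\esum_(k in [set: d.-tuple int])
             (normc (coef f (learnable_basis p k y)) ^+ 2)%:E)))].
Proof.
move=> _ mp p0 p1; split.
- by move=> f f2; exact: ae_L2_weighted.
- exists ((trigo.pi *+ 2) ^- d)%R, ((trigo.pi *+ 2) ^- d)%R; split => //.
    by rewrite invr_gt0 exprn_gt0// tau_gt0.
  by move=> f f2; rewrite parseval_weighted// lexx.
- by move=> f f2; rewrite parseval_weighted.
Qed.
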